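(* Let $\Omega$ be a domain in $\mathbb{R}^n$ ($n\geq 2$), let $u$ be a subharmonic function in $\Omega$, let $K$ be a Borel subset of $\Omega$ and let $x_0\in K$. Let $h:(0,+\infty)\to(0,+\infty)$ be a function such that there are real numbers $M>0$ and $c>4$ satisfying $$\int_0^{c\epsilon}\frac{h(r)}{r^{n-1}}\,dr\leq M\frac{h(\epsilon)}{\epsilon^{n-2}}$$ for all sufficiently small $\epsilon>0$. Suppose that there exist a positive Borel measure $\mu$ and real numbers $A,B>0$ and $\epsilon_0>0$ such that: 1. $\mu\big(K\cap\mathbb{B}(x_0,\epsilon)\big)\geq A\,h(\epsilon)$ for all $\epsilon<\epsilon_0$; 2. $\mu\big(K\cap\mathbb{B}(x,\epsilon)\big)\leq B\,h(\epsilon)$ for all $x\in K$ and all $\epsilon<\epsilon_0$. Then $$\lim_{\epsilon\to 0}\frac{1}{\mu\big(K\cap\mathbb{B}(x_0,\epsilon)\big)}\int_{K\cap\mathbb{B}(x_0,\epsilon)}u(x)\,d\mu(x)=u(x_0).$$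
   Context: $\mathbb{B}(x,r)$ denotes the open ball in $\mathbb{R}^n$ with center $x$ and radius $r$. A function $u:\Omega\to[-\infty,+\infty)$ is subharmonic if it is upper semicontinuous, not identically $-\infty$, and for every relatively compact open $G\subset\Omega$ and every $\varphi$ harmonic on $G$ and continuous on $\bar G$, $u\leq\varphi$ on $\partial G$ implies $u\leq\varphi$ on $G$. *)

(* Defs.v *)
From HB Require Import structures.
From mathcomp Require Import all_boot all_order all_algebra.
From mathcomp Require Import all_classical all_reals all_analysis.
Set Implicit Arguments. Unset Strict Implicit. Unset Printing Implicit Defensive.
Import Order.TTheory GRing.Theory Num.Theory.
Import numFieldNormedType.Exports.
Local Open Scope classical_set_scope.
Local Open Scope ring_scope.

(* Points of R^n are row vectors 'rV[R]_n.  The library's topology on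
   'rV[R]_n is the product topology (same as the Euclidean one), but
   balls B(x,r) in the statement are the EUCLIDEAN balls, defined here. *)

Definition enorm (R : realType) (n : nat) (x : 'rV[R]_n) : R :=
  Num.sqrt (\sum_(i < n) x ord0 i ^+ 2).

Definition eball (R : realType) (n : nat) (x : 'rV[R]_n) (r : R) : set 'rV[R]_n :=
  [set y | enorm (y - x) < r].

Definition partial (R : realType) (n : nat) (i : 'I_n) (f : 'rV[R]_n -> R)
  : 'rV[R]_n -> R := fun x => 'D_(delta_mx ord0 i) f x.

Definition laplacian (R : realType) (n : nat) (f : 'rV[R]_n -> R) (x : 'rV[R]_n) : R :=
  \sum_(i < n) partial i (partial i f) x.

Definition harmonic_on (R : realType) (n : nat) (G : set 'rV[R]_n)
  (phi : 'rV[R]_n -> R) : Prop :=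
  forall x, G x ->
    [/\ differentiable phi x,
        (forall i : 'I_n, differentiable (partial i phi) x),
        (forall i j : 'I_n, {for x, continuous (partial j (partial i phi))})
      & laplacian phi x = 0].

Definition usc_at (R : realType) (n : nat) (u : 'rV[R]_n -> \bar R) (x : 'rV[R]_n) : Prop :=
  forall a : R, (u x < a%:E)%E -> \forall y \near x, (u y < a%:E)%E.

Definition subharmonic (R : realType) (n : nat) (Omega : set 'rV[R]_n)
  (u : 'rV[R]_n -> \bar R) : Prop :=
  [/\ (forall x, Omega x -> u x != +oo%E),
      (forall x, Omega x -> usc_at u x),
      (exists x, Omega x /\ u x != -oo%E)
    & forall (G : set 'rV[R]_n) (phi : 'rV[R]_n -> R),
        open G -> compact (closure G) -> closure G `<=` Omega ->
        harmonic_on G phi -> {within closure G, continuous phi} ->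
        (forall x, (closure G `\` G) x -> (u x <= (phi x)%:E)%E) ->
        forall x, G x -> (u x <= (phi x)%:E)%E].

Definition borelRn (R : realType) (n : nat) :=
  g_sigma_algebraType (@open 'rV[R]_n).

Definition domain (R : realType) (n : nat) (Omega : set 'rV[R]_n) : Prop :=
  [/\ open Omega, connected Omega & Omega !=set0].

(* Main.v *)
(* Fix b slightly above u(x0); near x0 the function v = b - u is nonnegative and
   superharmonic, with v(x0) as small as desired.  The upper bound for the averages is upper
   semicontinuity, so it is enough to show that the average of v over K `&` B(x0, e) is at
   most C v(x0), with C independent of b and of e.

   The integral condition on h forces mu(K `&` B(x, e / 4^k)) to be at most
   C lam^k 4^(-k(n-2)) mu(K `&` B(x0, e)) for some lam < 1 and all x in K: mu is of dimension
   n - 2 plus a positive amount.  Hence the Newtonian (logarithmic if n = 2) potential of mu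
   restricted to a set F is small when mu(F) is small.  Comparing v, by the very definition of
   subharmonicity, with a multiple of the potential of finitely many point masses approximating
   mu on F = {v > t} gives a weak type bound for mu{v > t} which beats v(x0) / t by a
   geometric factor, so that it can be summed over a geometric sequence of levels t.  Neither
   the Riesz measure nor the mean value property is needed. *)

Require Import Defs.
From HB Require Import structures.
From mathcomp Require Import all_boot all_order all_algebra.
From mathcomp Require Import all_classical all_reals all_analysis.
From mathcomp Require Import measurable_realfun ring lra.
Import Order.TTheory GRing.Theory Num.Theory.
Import numFieldNormedType.Exports.
Local Open Scope classical_set_scope.
Local Open Scope ring_scope.

(** * Euclidean norm and balls *)

Section EuclideanNorm.
Context {R : realType} {n : nat}.
Implicit Types x y z : 'rV[R]_n.

Definition nsq x : R := \sum_(i < n) x ord0 i ^+ 2.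

Lemma nsq_ge0 x : 0 <= nsq x.
Proof. by apply: sumr_ge0 => i _; exact: sqr_ge0. Qed.

Lemma enorm_ge0 x : 0 <= enorm x.
Proof. exact: sqrtr_ge0. Qed.

Lemma enorm_sqr x : enorm x ^+ 2 = nsq x.
Proof. by rewrite sqr_sqrtr ?nsq_ge0. Qed.

Lemma enorm0 : enorm (0 : 'rV[R]_n) = 0.
Proof.
by rewrite /enorm big1 ?sqrtr0// => i _; rewrite mxE expr0n.
Qed.

Lemma enormN x : enorm (- x) = enorm x.
Proof.
by rewrite /enorm; congr Num.sqrt; apply: eq_bigr => i _; rewrite mxE sqrrN.
Qed.

Lemma enorm_subC x y : enorm (x - y) = enorm (y - x).
Proof. by rewrite -opprB enormN. Qed.

(** The squared norm of [|y| x - |x| y] expands to [2 |x| |y| (|x| |y| - x.y)]; the zero norms are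
    set aside so that the positive factor can be cancelled. *)
Lemma cauchy_schwarz x y :
  \sum_(i < n) x ord0 i * y ord0 i <= enorm x * enorm y.
Proof.
have [x0|x0] := eqVneq (enorm x) 0.
  rewrite x0 mul0r big1// => i _.
  have : nsq x = 0 by rewrite -enorm_sqr x0 expr0n.
  move=> /eqP; rewrite psumr_eq0; last by move=> j _; exact: sqr_ge0.
  by move=> /allP/(_ i (mem_index_enum _)); rewrite sqrf_eq0 => /eqP ->; rewrite mul0r.
have [y0|y0] := eqVneq (enorm y) 0.
  rewrite y0 mulr0 big1// => i _.
  have : nsq y = 0 by rewrite -enorm_sqr y0 expr0n.
  move=> /eqP; rewrite psumr_eq0; last by move=> j _; exact: sqr_ge0.
  by move=> /allP/(_ i (mem_index_enum _)); rewrite sqrf_eq0 => /eqP ->; rewrite mulr0.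
have xy : 0 < enorm x * enorm y by rewrite mulr_gt0// lt_def ?x0 ?y0 enorm_ge0.
have : 0 <= \sum_(i < n) (enorm y * x ord0 i - enorm x * y ord0 i) ^+ 2.
  by apply: sumr_ge0 => i _; exact: sqr_ge0.
set a := enorm x; set b := enorm y; set s := \sum_(i < n) x ord0 i * y ord0 i.
rewrite (eq_bigr (fun i => b ^+ 2 * x ord0 i ^+ 2 - (b * a * 2) * (x ord0 i * y ord0 i)
  + a ^+ 2 * y ord0 i ^+ 2)); last by move=> i _; ring.
rewrite !big_split/= sumrN -!mulr_sumr -/(nsq x) -/(nsq y) -!enorm_sqr -/a -/b -/s.
have -> : b ^+ 2 * a ^+ 2 - b * a * 2 * s + a ^+ 2 * b ^+ 2 =
  (a * b) * ((a * b - s) *+ 2) by ring.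
by rewrite pmulr_rge0// pmulrn_lge0// subr_ge0.
Qed.

Lemma enormD x y : enorm (x + y) <= enorm x + enorm y.
Proof.
rewrite -(@ler_pXn2r _ 2)// ?nnegrE ?addr_ge0 ?enorm_ge0//.
rewrite sqrrD !enorm_sqr.
have -> : nsq (x + y) = nsq x + (\sum_(i < n) x ord0 i * y ord0 i) *+ 2 + nsq y.
  rewrite -sumrMnl -!big_split/=; apply: eq_bigr => i _.
  by rewrite mxE sqrrD.
by rewrite lerD2r lerD2l lerMn2r/= cauchy_schwarz.
Qed.

Lemma enorm_tri z x y : enorm (x - y) <= enorm (x - z) + enorm (z - y).
Proof. by rewrite (le_trans _ (enormD _ _))// addrA subrK. Qed.

Lemma ler_coord_enorm x i : `|x ord0 i| <= enorm x.
Proof.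
rewrite -(@ler_pXn2r _ 2)// ?nnegrE ?enorm_ge0// enorm_sqr real_normK ?num_real//.
by rewrite /nsq (bigD1 i)//= lerDl sumr_ge0// => j _; exact: sqr_ge0.
Qed.

(** The topology of ['rV[R]_n] comes from the maximum norm; this inequality carries Euclidean
    estimates over to its neighbourhoods and bounded sets. *)
Lemma mx_norm_le_enorm x : `|x| <= enorm x.
Proof.
rewrite [leLHS]/Num.norm/= mx_normrE; apply/bigmax_leP; split; first exact: enorm_ge0.
by move=> [i j] _ /=; rewrite (ord1 i) ler_coord_enorm.
Qed.

Lemma continuous_nsq : continuous nsq.
Proof.
apply: (@continuous_big _ _ +%R 0 xpredT add_continuous) => i _ x.
apply: (@continuous_comp _ _ _ (fun z : 'rV[R]_n => z ord0 i) (fun t => t ^+ 2)).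
  exact: coord_continuous.
exact: exprn_continuous.
Qed.

Lemma continuous_enorm : continuous (@enorm R n).
Proof.
move=> x; apply: (continuous_comp (continuous_nsq x)); exact: sqrt_continuous.
Qed.

Lemma continuous_enormB y : continuous (fun x => enorm (x - y)).
Proof.
move=> x; apply: (@continuous_comp _ _ _ (fun x => x - y) (@enorm R n)).
  apply: differentiable_continuous; apply: differentiableB; first exact: ex_diff.
  exact: differentiable_cst.
exact: continuous_enorm.
Qed.

Lemma open_eball y r : open (eball y r).
Proof.
rewrite (_ : eball y r = (fun x => enorm (x - y)) @^-1` [set t | t < r])//.
by apply: open_comp; [move=> x _; exact: continuous_enormB|exact: open_lt].
Qed.

Definition ecball y r : set 'rV[R]_n := [set x | enorm (x - y) <= r].

Lemma closed_ecball y r : closed (ecball y r).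
Proof.
rewrite (_ : ecball y r = (fun x => enorm (x - y)) @^-1` [set t | t <= r])//.
by apply: closed_comp; [move=> x _; exact: continuous_enormB|exact: closed_le].
Qed.

Lemma open_enorm_gt y r : open [set x | r < enorm (x - y)].
Proof.
apply: (@open_comp _ _ (fun x => enorm (x - y)) [set t | r < t]) => [x _|].
  exact: continuous_enormB.
exact: open_gt.
Qed.

Lemma closed_enorm_ge y r : closed [set x | r <= enorm (x - y)].
Proof.
apply: (@closed_comp _ _ (fun x => enorm (x - y)) [set t | r <= t]) => [x _|].
  exact: continuous_enormB.
exact: closed_ge.
Qed.

Lemma compact_ecball y r : compact (ecball y r).
Proof.
apply: bounded_closed_compact; last exact: closed_ecball.
exists (`|r + enorm y|); split; first exact: num_real.
move=> M rM x xy; apply: (le_trans (mx_norm_le_enorm x)); rewrite -[x](subrK y).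
apply: (le_trans (enormD _ _)); apply: ltW; apply: le_lt_trans rM.
by apply: (le_trans _ (ler_norm _)); rewrite lerD2r.
Qed.

Lemma nbhs_ecball (U : set 'rV[R]_n) x : nbhs x U ->
  exists2 r, 0 < r & ecball x r `<=` U.
Proof.
rewrite -nbhs_ballE => -[r/= r0 rU]; exists (r / 2); first by rewrite divr_gt0.
move=> y xy; apply: rU; rewrite -ball_normE/= distrC.
apply: (le_lt_trans (mx_norm_le_enorm _)); apply: (le_lt_trans xy).
by rewrite ltr_pdivrMr// mulr2n mulrDr mulr1 ltrDl.
Qed.

End EuclideanNorm.

(** * Harmonic functions and the fundamental solution *)

(** The first-order expansion of [f] at [x] is also one of [g], and uniqueness of the differential
    identifies its linear part. This lets a partial derivative be replaced by a formula known only
    near a point. *)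
Lemma near_eq_differentiable (R : numFieldType) (V W : normedModType R)
    (f g : V -> W) (x : V) :
  (\forall z \near x, f z = g z) -> differentiable f x -> differentiable g x.
Proof.
move=> fg df.
have [dfc /eqaddoP fo] := (diff_locallyP x f).1 df.
have go : g \o shift x = cst (g x) + 'd f x +o_ 0 id.
  apply/eqaddoP => e e0; have := fo e e0; rewrite /= => foe.
  have fg0 : \forall z \near 0, f (z + x) = g (z + x).
    by have := fg; rewrite (near_shift 0 x); apply: filterS => z; rewrite /= subr0.
  near=> z.
  have -> : (g \o shift x - (cst (g x) + 'd f x)) z =
            (f \o shift x - (cst (f x) + 'd f x)) z.
    rewrite /= !fctE /= -(nbhs_singleton fg); congr (_ - _).
    by apply/esym; near: z.
  by near: z.
have dgE := diff_unique dfc go.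
by apply/diff_locallyP; rewrite dgE.
Unshelve. all: by end_near. Qed.

Lemma near_eq_continuous (V W : topologicalType) (f g : V -> W) (x : V) :
  (\forall z \near x, f z = g z) ->
  {for x, continuous f} -> {for x, continuous g}.
Proof.
move=> fg cf; rewrite /prop_for /continuous_at -(nbhs_singleton fg).
by apply: cvg_trans cf; apply: near_eq_cvg.
Qed.

Section RadialKernel.
Context {R : realType} {n : nat}.
Variable y : 'rV[R]_n.
Implicit Types (x z : 'rV[R]_n) (i j : 'I_n).

Let c i : 'rV[R]_n -> R := fun z => z ord0 i - y ord0 i.

Let differentiable_c i x : differentiable (c i) x.
Proof.
apply: differentiableB; first exact: differentiable_coord.
exact: differentiable_cst.
Qed.

Let is_derive_c i x (v : 'rV[R]_n) : is_derive x v (c i) (v ord0 i).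
Proof.
apply: DeriveDef; first exact: diff_derivable.
rewrite /derive; apply: cvg_lim => //.
apply: cvg_near_cst; near=> h.
have h0 : h != 0 by near: h; exact: nbhs_dnbhs_neq.
rewrite /c /= !mxE /GRing.scale/=.
by rewrite opprB addrA subrK addrK mulKf.
Unshelve. all: by end_near. Qed.

#[local] Existing Instance is_derive_c.

(** The squared distance is a polynomial, so writing radial functions through it avoids
    differentiating a square root. *)
Let rad : 'rV[R]_n -> R := fun x => nsq (x - y).

Let radE : rad = \sum_(i < n) (c i) ^+ 2.
Proof.
apply/funext => x; rewrite fct_sumE; apply: eq_bigr => i _.
by rewrite !mxE.
Qed.

Let differentiable_rad x : differentiable rad x.
Proof. by rewrite radE; apply: differentiable_sum => i; exact: differentiableX. Qed.

Let derive_rad i x : 'D_(delta_mx ord0 i) rad x = 2 * c i x.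
Proof.
rewrite radE derive_sum; last by move=> k; apply: derivableX; exact: ex_derive.
rewrite (bigD1 i)//= big1 ?addr0; last first.
  move=> k ki; rewrite deriveX; last exact: ex_derive.
  by rewrite derive_val mxE/= (negbTE ki) /= scaler0.
rewrite deriveX; last exact: ex_derive.
by rewrite derive_val mxE !eqxx/= expr1 /GRing.scale/= mulr1.
Qed.

Lemma radial_differentiable (f : R -> R) (df : R) x :
  is_derive (nsq (x - y)) 1 f df ->
  differentiable (fun z => f (nsq (z - y))) x.
Proof.
move=> fdf; apply: (@differentiable_comp _ _ _ _ rad f); first exact: differentiable_rad.
by apply/derivable1_diffP; exact: ex_derive.
Qed.

Lemma radial_partial (f : R -> R) (df : R) x i :
  is_derive (nsq (x - y)) 1 f df ->
  partial i (fun z => f (nsq (z - y))) x = df * (2 * (x ord0 i - y ord0 i)).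
Proof.
move=> fdf; have dF := @radial_differentiable f df x fdf.
have df1 : differentiable f (rad x) by apply/derivable1_diffP; exact: ex_derive.
rewrite /partial deriveE// (@diff_comp _ _ _ _ rad f)//=.
rewrite diff1E// -deriveE// derive_rad derive1E /GRing.scale/= mulrC; congr (_ * _).
exact: derive_val.
Qed.

Let open_neq : open (~` [set y]).
Proof.
apply: closed_openC; apply: accessible_closed_set1; apply: hausdorff_accessible.
exact: norm_hausdorff.
Qed.

Let rad_gt0 x : (~` [set y]) x -> 0 < rad x.
Proof.
move=> xy; rewrite lt_def nsq_ge0 andbT; apply/negP => /eqP r0; apply: xy => /=.
apply/eqP; rewrite -subr_eq0 -normr_le0 (le_trans (mx_norm_le_enorm _))//.
by rewrite /enorm -/(nsq _) -/(rad x) r0 sqrtr0.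
Qed.

(** With [s = |x - y|^2] the Laplacian is [4 s f2(s) + 2 n f1(s)], twice the left side of the last
    hypothesis. *)
Lemma harmonic_radial (f f1 f2 : R -> R) :
  (forall s : R, 0 < s -> is_derive s 1 f (f1 s)) ->
  (forall s : R, 0 < s -> is_derive s 1 f1 (f2 s)) ->
  (forall s : R, 0 < s -> {for s, continuous f2}) ->
  (forall s : R, 0 < s -> 2 * s * f2 s + n%:R * f1 s = 0) ->
  harmonic_on (~` [set y]) (fun x => f (nsq (x - y))).
Proof.
move=> ff1 ff2 cf2 lap x Wx.
(* [P i] is the closed form of the first partial. The two agree on an open set, hence near each of
   its points, so they have the same derivatives there. *)
pose P i x := f1 (rad x) * (2 * c i x).
have EP i z : (~` [set y]) z -> partial i (fun x => f (nsq (x - y))) z = P i z.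
  by move=> /rad_gt0 z0; apply: radial_partial; exact: ff1.
have nEP i z : (~` [set y]) z ->
    \forall w \near z, P i w = partial i (fun x => f (nsq (x - y))) w.
  move=> Wz; have : nbhs z (~` [set y]) by exact: open_nbhs_nbhs.
  by apply: filterS => w Ww; rewrite EP.
have dP i z : (~` [set y]) z -> differentiable (P i) z.
  move=> /rad_gt0 z0; apply: differentiableM.
    by apply: radial_differentiable; exact: ff2.
  apply: differentiableM; first exact: differentiable_cst.
  exact: differentiable_c.
have PP i j z : (~` [set y]) z ->
    partial j (P i) z = f2 (rad z) * (2 * c j z) * (2 * c i z) +
      f1 (rad z) * (2 * (i == j)%:R).
  move=> /rad_gt0 z0; rewrite /partial.
  have d1 : derivable (fun w => f1 (rad w)) z (delta_mx ord0 j).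
    by apply: diff_derivable; apply: radial_differentiable; exact: ff2.
  have d2 : is_derive z (delta_mx ord0 j) (fun w => 2 * c i w) (2 * (i == j)%:R).
    have := @is_deriveZ _ _ _ (c i) 2 z (delta_mx ord0 j) _ (is_derive_c i z _).
    by rewrite mxE eqxx.
  have [_ ->] := @is_deriveM _ _ (fun w => f1 (rad w)) (fun w => 2 * c i w) z
    (delta_mx ord0 j) _ _ (derivableP d1) d2.
  have := @radial_partial f1 _ z j (ff2 _ z0); rewrite /partial => ->.
  by rewrite /GRing.scale/= addrC [in LHS]mulrC.
have nPP i j z : (~` [set y]) z ->
    partial j (partial i (fun x => f (nsq (x - y)))) z = partial j (P i) z.
  move=> Wz; apply: near_eq_derive; have := nEP i z Wz.
  by apply: filterS => w ->.
split.
- by apply: radial_differentiable; apply: ff1; exact: rad_gt0.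
- by move=> i; exact: (@near_eq_differentiable _ _ _ (P i) _ x (nEP i x Wx) (dP i x Wx)).
- move=> i j.
  pose Q z := f2 (rad z) * (2 * c j z) * (2 * c i z) + f1 (rad z) * (2 * (i == j)%:R).
  apply: (@near_eq_continuous _ _ Q).
    have : nbhs x (~` [set y]) by exact: open_nbhs_nbhs.
    by apply: filterS => w Ww; rewrite nPP// PP.
  have cc k : {for x, continuous (fun z => 2 * c k z)}.
    apply: differentiable_continuous; apply: differentiableM.
      exact: differentiable_cst.
    exact: differentiable_c.
  have crad : {for x, continuous (fun z => f2 (rad z))}.
    apply: continuous_comp; last by apply: cf2; exact: rad_gt0.
    exact: differentiable_continuous.
  have cf1 : {for x, continuous (fun z => f1 (rad z))}.
    apply: differentiable_continuous; apply: radial_differentiable.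
    by apply: ff2; exact: rad_gt0.
  have cst2 : {for x, continuous (fun _ : 'rV[R]_n => 2 * (i == j)%:R : R)}.
    exact: cst_continuous.
  exact: (continuousD (continuousM (continuousM crad (cc j)) (cc i)) (continuousM cf1 cst2)).
- rewrite /laplacian (eq_bigr (fun i => 4 * f2 (rad x) * c i x ^+ 2 + 2 * f1 (rad x))).
    rewrite big_split/= -mulr_sumr sumr_const card_ord.
    have -> : \sum_(i < n) c i x ^+ 2 = rad x by apply: eq_bigr => i _; rewrite !mxE.
    rewrite -[_ *+ n]mulr_natr; have := lap _ (rad_gt0 _ Wx) => lx.
    by transitivity (2 * (2 * rad x * f2 (rad x) + n%:R * f1 (rad x))); [ring|rewrite lx mulr0].
  by move=> i _; rewrite nPP// PP// eqxx/=; ring.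
Qed.

End RadialKernel.

(** * Linear combinations of harmonic functions *)

Section HarmonicClosure.
Context {R : realType} {n : nat}.
Implicit Types (G : set 'rV[R]_n) (f g : 'rV[R]_n -> R).

Lemma harmonic_on_subset G G' f : G' `<=` G -> harmonic_on G f -> harmonic_on G' f.
Proof. by move=> GG' fG x /GG' /fG. Qed.

Lemma harmonic_on_cst G (a : R) : harmonic_on G (cst a).
Proof.
have pc (b : R) i : partial i (@cst 'rV[R]_n R b) = cst 0.
  by apply/funext => x; rewrite /partial derive_cst.
move=> x _; split.
- exact: differentiable_cst.
- by move=> i; rewrite pc; exact: differentiable_cst.
- by move=> i j; rewrite !pc; exact: cst_continuous.
- by rewrite /laplacian big1// => i _; rewrite !pc.
Qed.

(** Since [G] is open, the formula for the first partials holds near each point of [G] and can be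
    differentiated again. *)
Lemma harmonic_on_lincomb G (a : R) f g : open G -> harmonic_on G f -> harmonic_on G g ->
  harmonic_on G (fun x => a * f x + g x).
Proof.
move=> oG hf hg x Gx.
have pE (u v : 'rV[R]_n -> R) i z : differentiable u z -> differentiable v z ->
    partial i (fun x => a * u x + v x) z = a * partial i u z + partial i v z.
  move=> du dv; rewrite /partial.
  have d1 := @is_deriveZ _ _ _ u a z _ _ (derivableP (diff_derivable (v := delta_mx ord0 i) du)).
  have [_ E] := @is_deriveD _ _ _ (fun x => a * u x) v z (delta_mx ord0 i) _ _ d1
    (derivableP (diff_derivable dv)).
  by rewrite [LHS]E.
have dl (u v : 'rV[R]_n -> R) z : differentiable u z -> differentiable v z ->
    differentiable (fun x => a * u x + v x) z.
  by move=> du dv; apply: differentiableD => //; exact: (@differentiableZ _ _ _ u a z).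
have p1 i z : G z -> partial i (fun x => a * f x + g x) z =
    a * partial i f z + partial i g z.
  by move=> Gz; apply: pE; [have [] := hf z Gz|have [] := hg z Gz].
have np1 i z : G z -> \forall w \near z, a * partial i f w + partial i g w =
    partial i (fun x => a * f x + g x) w.
  move=> Gz; have : nbhs z G by exact: open_nbhs_nbhs.
  by apply: filterS => w Gw; rewrite p1.
have p2 i j z : G z -> partial j (partial i (fun x => a * f x + g x)) z =
    a * partial j (partial i f) z + partial j (partial i g) z.
  move=> Gz; rewrite -pE; [|by have [_] := hf z Gz|by have [_] := hg z Gz].
  rewrite /partial; apply/esym/near_eq_derive; exact: np1.
have [df dpf cf lf] := hf x Gx; have [dg dpg cg lg] := hg x Gx.
split.
- exact: dl.
- move=> i; apply: (near_eq_differentiable _ _ _ _ _ _ (np1 i x Gx)).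
  exact: dl.
- move=> i j.
  apply: (@near_eq_continuous _ _
    (fun z => a * partial j (partial i f) z + partial j (partial i g) z)).
    have : nbhs x G by exact: open_nbhs_nbhs.
    by apply: filterS => w Gw; rewrite p2.
  have ca : {for x, continuous (fun _ : 'rV[R]_n => a)} by exact: cst_continuous.
  exact: (continuousD (continuousM ca (cf i j)) (cg i j)).
- rewrite /laplacian (eq_bigr _ (fun i _ => p2 i i x Gx)).
  have E (u v : 'I_n -> R) : \sum_i (a * u i + v i) = a * \sum_i u i + \sum_i v i.
    by rewrite big_split/= mulr_sumr.
  move: lf lg; rewrite /laplacian => lf lg; rewrite E [X in a * X]lf [X in _ + X]lg.
  by rewrite mulr0 addr0.
Qed.

Lemma harmonic_on_sum G (I : eqType) (s : seq I) (a : I -> R) (F : I -> 'rV[R]_n -> R) :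
  open G -> (forall i, i \in s -> harmonic_on G (F i)) ->
  harmonic_on G (fun x => \sum_(i <- s) a i * F i x).
Proof.
move=> oG; elim: s => [|i s ih] hF.
  rewrite (_ : (fun _ => _) = cst 0); first exact: harmonic_on_cst.
  by apply/funext => x; rewrite big_nil.
rewrite (_ : (fun _ => _) = fun x => a i * F i x + \sum_(i <- s) a i * F i x).
  apply: (harmonic_on_lincomb _ (a i) (F i) _ oG); first by apply: hF; rewrite mem_head.
  by apply: ih => j js; apply: hF; rewrite in_cons js orbT.
by apply/funext => x; rewrite big_cons.
Qed.

End HarmonicClosure.

Section FundamentalSolution.
Context {R : realType}.
Variable n : nat.

Let p : R := n%:R / 2.

(* [fund (|x|^2)] is a fundamental solution of the Laplacian; the normalisation
   fund'(s) = - s^(-n/2) is the same in the logarithmic and in the Newtonian case. *)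
Definition fund (s : R) : R :=
  if n == 2%N then - ln s else s `^ (1 - n%:R / 2) / (n%:R / 2 - 1).

Lemma is_derive_fund (s : R) : 0 < s -> is_derive s 1 fund (- s `^ (- p)).
Proof.
move=> s0; rewrite /fund /p; have [->|n2'] := eqVneq n 2%N.
  rewrite divff// powR_inv1 ?ltW//.
  have ? := is_derive1_ln s0.
  exact: is_deriveN.
have p1 : (n%:R / 2 - 1 : R) != 0.
  rewrite subr_eq0; apply/eqP => h; move/eqP: n2'; apply.
  apply/eqP; rewrite -(eqr_nat R); apply/eqP.
  by rewrite -[LHS](@divfK _ 2)// h mul1r.
have d := is_derive1_powR (1 - n%:R / 2) s0.
have E : (fun s : R => s `^ (1 - n%:R / 2) / (n%:R / 2 - 1)) =
    (n%:R / 2 - 1)^-1 *: (fun s : R => s `^ (1 - n%:R / 2)).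
  by apply/funext => t; rewrite [LHS]mulrC.
rewrite E; apply: (is_derive_eq (@is_deriveZ _ _ _ _ _ s 1 _ d)); rewrite /GRing.scale/=.
by rewrite addrAC subrr add0r mulrA -(opprB _ 1) mulrN mulVf// mulN1r.
Qed.

Lemma harmonic_fund (y : 'rV[R]_n) :
  harmonic_on (~` [set y]) (fun x => fund (nsq (x - y))).
Proof.
have D2 (s : R) : 0 < s -> is_derive s 1 (fun s => - s `^ (- p)) (p * s `^ (- p - 1)).
  move=> s0; have d := is_derive1_powR (- p) s0.
  have := @is_deriveN _ _ _ (fun s => s `^ (- p)) s 1 _ d.
  by rewrite mulNr opprK.
apply: (harmonic_radial y _ (fun s => - s `^ (- p)) (fun s => p * s `^ (- p - 1))) => //.
- exact: is_derive_fund.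
- move=> s s0; have d := is_derive1_powR (- p - 1) s0.
  apply: continuousM; first exact: cst_continuous.
  by apply: differentiable_continuous; apply/derivable1_diffP; exact: ex_derive.
- move=> s s0; rewrite powRB; last by rewrite (gt_eqF s0) implybT.
  rewrite powRr1 ?ltW//.
  have nE : n%:R = 2 * p by rewrite /p mulrC divfK.
  rewrite nE; set w := s `^ (- p).
  by field; rewrite gt_eqF.
Qed.

(** The mean value theorem involves only the derivative [- t^(-n/2)], so the bounds drawn from it
    treat the logarithmic and the Newtonian kernel together. *)
Lemma fund_mvt (r s : R) : 0 < r -> r <= s ->
  exists2 t, r ^+ 2 <= t <= s ^+ 2 &
  fund (r ^+ 2) - fund (s ^+ 2) = (s ^+ 2 - r ^+ 2) * t `^ (- p).
Proof.
move=> r0 rs; have r20 : 0 < r ^+ 2 by rewrite exprn_gt0.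
have rs2 : r ^+ 2 <= s ^+ 2 by rewrite ler_pXn2r ?nnegrE ?(ltW r0)// (le_trans (ltW r0)).
have [| |t tI E] := @MVT_segment R fund (fun t => - t `^ (- p)) (r ^+ 2) (s ^+ 2) rs2.
- by move=> t; rewrite in_itv/= => /andP[rt _]; apply: is_derive_fund; exact: lt_trans rt.
- apply: derivable_within_continuous => t; rewrite in_itv/= => /andP[rt _].
  by have := is_derive_fund t (lt_le_trans r20 rt) => h; exact: ex_derive.
- exists t; first by move: tI; rewrite in_itv.
  by rewrite -opprB E mulNr opprK mulrC.
Qed.

Let powR_sqr (r : R) : 0 < r -> (r ^+ 2) `^ (- p) = r ^- n.
Proof.
move=> r0; rewrite powRN; congr (_^-1).
by rewrite -powR_mulrn ?ltW// -powRrM /p mulrC divfK// powR_mulrn// ltW.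
Qed.

Let powR_noninc (a b : R) : 0 < a -> a <= b -> b `^ (- p) <= a `^ (- p).
Proof.
move=> a0 ab; rewrite !powRN lef_pV2 ?posrE ?powR_gt0//; last exact: lt_le_trans ab.
apply: ge0_ler_powR => //; rewrite ?nnegrE ?(ltW a0) ?(le_trans (ltW a0) ab)//.
by rewrite /p divr_ge0.
Qed.

Lemma fund_ub (r s : R) : 0 < r -> r <= s ->
  fund (r ^+ 2) - fund (s ^+ 2) <= (s ^+ 2 - r ^+ 2) / r ^+ n.
Proof.
move=> r0 rs; have [t /andP[rt ts] ->] := fund_mvt r s r0 rs.
rewrite -powR_sqr// ler_wpM2l ?subr_ge0 ?(le_trans rt)//.
by apply: powR_noninc => //; rewrite exprn_gt0.
Qed.

Lemma fund_lb (r s : R) : 0 < r -> r <= s ->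
  (s ^+ 2 - r ^+ 2) / s ^+ n <= fund (r ^+ 2) - fund (s ^+ 2).
Proof.
move=> r0 rs; have [t /andP[rt ts] ->] := fund_mvt r s r0 rs.
rewrite -powR_sqr ?(lt_le_trans r0)// ler_wpM2l ?subr_ge0 ?(le_trans rt)//.
by apply: powR_noninc => //; apply: lt_le_trans rt; rewrite exprn_gt0.
Qed.

Lemma fund_noninc (r s : R) : 0 < r -> r <= s -> fund (s ^+ 2) <= fund (r ^+ 2).
Proof.
move=> r0 rs; rewrite -subr_ge0; apply: le_trans (fund_lb r s r0 rs).
have s0 := le_trans (ltW r0) rs.
apply: divr_ge0; last exact: exprn_ge0.
by rewrite subr_ge0 ler_pXn2r ?nnegrE ?(ltW r0)// (le_trans (ltW r0)).
Qed.

End FundamentalSolution.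

(** * Comparison with potentials of point masses *)

Lemma open_all (T : topologicalType) (I : eqType) (l : seq I) (P : I -> set T) :
  (forall i, i \in l -> open (P i)) -> open [set x | forall i, i \in l -> P i x].
Proof.
elim: l => [|i l ih] oP.
  by rewrite (_ : [set _ | _] = setT); [exact: openT|apply/seteqP; split].
rewrite (_ : [set _ | _] = P i `&` [set x | forall i, i \in l -> P i x]).
  apply: openI; first by apply: oP; rewrite mem_head.
  by apply: ih => j jl; apply: oP; rewrite in_cons jl orbT.
apply/seteqP; split=> x /=.
  move=> H; split; first by apply: H; rewrite mem_head.
  by move=> j jl; apply: H; rewrite in_cons jl orbT.
by move=> [Pi H] j; rewrite in_cons => /predU1P[->//|/H].
Qed.

Lemma closed_all (T : topologicalType) (I : eqType) (l : seq I) (P : I -> set T) :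
  (forall i, i \in l -> closed (P i)) -> closed [set x | forall i, i \in l -> P i x].
Proof.
move=> cP; rewrite (_ : [set _ | _] = \bigcap_(i in [set i | i \in l]) P i)//.
by apply: closed_bigI => i /cP.
Qed.

Section Capacity.
Context {R : realType} {n : nat}.
Variables (Omega : set 'rV[R]_n) (u : 'rV[R]_n -> \bar R).
Hypothesis (subh : subharmonic Omega u).

(* The entries (y, w) of [l] are point masses w at y.  Outside the closed balls of radius eta
   around them, u is compared with b minus t / Q times their potential. *)
Lemma capacity_bound (x0 : 'rV[R]_n) (e eta b t Q u0 : R) (l : seq ('rV[R]_n * R)) :
  0 < e -> 0 < eta -> 0 < t -> 0 < Q ->
  ecball x0 (5 * e) `<=` Omega ->
  (forall x, ecball x0 (5 * e) x -> (u x <= b%:E)%E) ->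
  (forall q, q \in l -> [/\ 0 <= q.2, enorm (q.1 - x0) < e &
     forall x, ecball q.1 eta x -> (u x <= (b - t)%:E)%E]) ->
  (forall x q, q \in l -> enorm (x - q.1) <= eta ->
     (forall q', q' \in l -> eta <= enorm (x - q'.1)) ->
     \sum_(q' <- l) q'.2 * (fund n (nsq (x - q'.1)) - fund n ((4 * e) ^+ 2)) <= Q) ->
  u x0 = u0%:E -> b - t < u0 ->
  t * ((15 * e ^+ 2) / (4 * e) ^+ n * \sum_(q <- l) q.2) <= Q * (b - u0).
Proof.
move=> e0 eta0 t0 Q0 bO ub lP potQ ux0 btu0.
(* Subtracting [C0] makes the kernel vanish at distance [4 * e]. The sphere of radius [5 * e] about
   [x0] is at least that far from every mass, so the potential is nonpositive there and
   [phi >= b]. *)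
pose C0 := fund n ((4 * e) ^+ 2).
pose W := [set x : 'rV[R]_n | forall q, q \in l -> x <> q.1].
pose S (x : 'rV[R]_n) := \sum_(q <- l) q.2 * fund n (nsq (x - q.1)).
pose phi x := (- (t / Q)) * S x + (b + t / Q * \sum_(q <- l) q.2 * C0).
have phiE x : phi x = b - t / Q * \sum_(q <- l) q.2 * (fund n (nsq (x - q.1)) - C0).
  have -> : \sum_(q <- l) q.2 * (fund n (nsq (x - q.1)) - C0) =
      S x - \sum_(q <- l) q.2 * C0.
    by rewrite /S -sumrB; apply: eq_bigr => q _; rewrite mulrBr.
  by rewrite /phi; ring.
have oW : open W.
  apply: open_all => q _.
  apply: closed_openC; apply: accessible_closed_set1; apply: hausdorff_accessible.
  exact: norm_hausdorff.
have hphi : harmonic_on W phi.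
  apply: harmonic_on_lincomb => //; last exact: harmonic_on_cst.
  apply: (harmonic_on_sum W _ l (fun q => q.2) (fun q x => fund n (nsq (x - q.1))) oW) => q ql.
  have h := harmonic_fund n q.1; apply: (harmonic_on_subset _ _ _ _ h).
  by move=> x /(_ q ql).
pose G := [set x | enorm (x - x0) < 5 * e] `&`
  [set x | forall q, q \in l -> eta < enorm (x - q.1)].
have oG : open G.
  apply: openI; first exact: open_eball.
  apply: open_all => q _.
  exact: open_enorm_gt.
(* A closed superset of [G] that avoids the poles; it replaces an exact description of
   [closure G]. *)
pose C := ecball x0 (5 * e) `&` [set x | forall q, q \in l -> eta <= enorm (x - q.1)].
have cC : closed C.
  apply: closedI; first exact: closed_ecball.
  apply: closed_all => q _.
  exact: closed_enorm_ge.
have GC : G `<=` C by move=> x [/ltW xe xl]; split => // q /xl /ltW.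
have clC : closure G `<=` C by rewrite [X in _ `<=` X](closure_id C).1//; exact: closure_subset.
have CW : C `<=` W.
  move=> x [_ xl] q ql xq; have := xl q ql.
  by rewrite xq subrr enorm0 leNgt eta0.
have [_ _ _ /(_ G phi oG)] := subh.
have cclG : compact (closure G).
  apply: (subclosed_compact _ (compact_ecball x0 (5 * e))) => [|x /clC []//].
  exact: closed_closure.
move=> /(_ cclG) H.
have {}H := H (subset_trans clC (subset_trans (@subIsetl _ _ _) bO)).
have {}H := H (harmonic_on_subset _ _ _ (subset_trans GC CW) hphi).
have cphi : {within closure G, continuous phi}.
  apply: continuous_in_subspaceT => x /[!inE] /clC /CW Wx.
  by apply: differentiable_continuous; have [] := hphi x Wx.
have {}H := H cphi.
have tQ : 0 < t / Q by rewrite divr_gt0.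
(* A boundary point is either within [eta] of a mass, where [u <= b - t] and the potential is at
   most [Q], or on the outer sphere. *)
have bdry x : (closure G `\` G) x -> (u x <= (phi x)%:E)%E.
  move=> [/clC [xe xl] nG].
  have [xe'|xe'] := ltP (enorm (x - x0)) (5 * e).
    have [q ql xq] : exists2 q, q \in l & enorm (x - q.1) <= eta.
      apply: contrapT => nq; apply: nG; split => // q ql.
      by rewrite ltNge; apply/negP => xq; apply: nq; exists q.
    have [_ _ uq] := lP q ql.
    apply: (le_trans (uq x xq)); rewrite lee_fin phiE lerD2l lerN2.
    rewrite -ler_pdivlMl// invf_div divfK ?gt_eqF//.
    by apply: (potQ x q) => // q' /xl.
  apply: (le_trans (ub x xe)); rewrite lee_fin phiE lerDl oppr_ge0.
  rewrite pmulr_rle0//; rewrite big_seq; apply: sumr_le0 => q ql.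
  have [q0 qx0 _] := lP q ql; rewrite mulr_ge0_le0// subr_le0.
  rewrite -enorm_sqr /C0; apply: fund_noninc => //; first by rewrite mulr_gt0.
  have := enorm_tri q.1 x x0; lra.
have {}H := H bdry.
(* [x0] is not within [eta] of any mass, because [u] is at most [b - t < u0] there. *)
have G0 : G x0.
  split=> [/=|q ql]; first by rewrite subrr enorm0 mulr_gt0.
  rewrite ltNge; apply/negP => xq; have [_ _ /(_ x0 xq)] := lP q ql.
  by rewrite ux0 lee_fin leNgt btu0.
have := H x0 G0; rewrite ux0 lee_fin phiE => {}H.
(* Every mass is within [e] of [x0], so each kernel value is at least the drop of [fund] from radius
   [e] to [4 * e]; the 15 is [4 ^+ 2 - 1]. *)
have S0 : (15 * e ^+ 2) / (4 * e) ^+ n * \sum_(q <- l) q.2 <=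
    \sum_(q <- l) q.2 * (fund n (nsq (x0 - q.1)) - C0).
  rewrite mulr_sumr big_seq [leRHS]big_seq; apply: ler_sum => q ql.
  have [q0 qx0 _] := lP q ql; rewrite mulrC ler_wpM2l// /C0 -enorm_sqr.
  have e4 : e <= 4 * e by lra.
  apply: (@le_trans _ _ (fund n (e ^+ 2) - fund n ((4 * e) ^+ 2))).
    apply: le_trans (fund_lb n e (4 * e) e0 e4).
    by rewrite ler_wpM2r ?invr_ge0 ?exprn_ge0 ?mulr_ge0 ?(ltW e0)// exprMn; lra.
  rewrite lerD2r; apply: fund_noninc => //; last by rewrite enorm_subC ltW.
  by have [_ /(_ q ql) /(lt_trans eta0)] := G0.
set m := _ * \sum_(q <- l) q.2 in S0 *.
have -> : t * m = Q * (t / Q * m) by field; rewrite gt_eqF.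
rewrite ler_pM2l//.
apply: (@le_trans _ _ (t / Q * \sum_(q <- l) q.2 * (fund n (nsq (x0 - q.1)) - C0))).
  by rewrite ler_pM2l.
lra.
Qed.

End Capacity.

(** * Approximation of a measure by point masses *)

Section Discretization.
Context {R : realType} {n : nat} (mu : {measure set (borelRn R n) -> \bar R}).
Local Notation T := (borelRn R n).

Lemma open_measurable_Rn (U : set T) : @open 'rV[R]_n U -> measurable U.
Proof. by move=> oU; exact: sub_sigma_algebra. Qed.

Lemma measurable_eball (x : 'rV[R]_n) (r : R) : measurable (eball x r : set T).
Proof. by apply: open_measurable_Rn; exact: open_eball. Qed.

Let discretization (F : set T) (eta : R) (l : seq ('rV[R]_n * R)) :=
  [/\ forall q, q \in l -> F q.1 /\ 0 <= q.2,
      (\sum_(q <- l) q.2)%:E = mu F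
    & forall (x : 'rV[R]_n) r,
      ((\sum_(q <- l | enorm (x - q.1) < r) q.2)%:E <= mu (F `&` eball x (r + eta)))%E].

(** Induction on the centres: the part of [F] in the first ball is cut off and its mass is put at
    one of its own points. Choosing a point of [F] and not the centre keeps the masses in [F], where
    the growth bound on [mu] is available. *)
Lemma discretize_cover (eta : R) (zs : seq 'rV[R]_n) (F : set T) :
  measurable F -> (mu F < +oo)%E ->
  (forall x, F x -> exists2 z, z \in zs & enorm (x - z) < eta / 2) ->
  exists l, discretization F eta l.
Proof.
elim: zs F => [|z zs ih] F mF Foo Fz.
  have -> : F = set0 by apply/seteqP; split => x // /Fz[].
  exists [::]; split => //; first by rewrite big_nil measure0.
  by move=> x r; rewrite big_nil measure_ge0.
have mB := measurable_eball z (eta / 2).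
have mF1 : measurable (F `&` eball z (eta / 2)) by exact: measurableI.
have mF2 : measurable (F `\` eball z (eta / 2)) by exact: measurableD.
have muF (G : set T) : measurable G ->
    mu (F `&` G) = (mu ((F `&` eball z (eta / 2)) `&` G) + mu ((F `\` eball z (eta / 2)) `&` G))%E.
  move=> mG; rewrite -measureU//; [|exact: measurableI|exact: measurableI|].
    by rewrite -setIUl setUIDK.
  by apply/seteqP; split => x //= [[[_ ?] _] [[_ ?] _]].
have F2oo : (mu (F `\` eball z (eta / 2)) < +oo)%E.
  by apply: le_lt_trans Foo; rewrite le_measure ?inE//; exact: subDsetl.
have F1oo : (mu (F `&` eball z (eta / 2)) < +oo)%E.
  by apply: le_lt_trans Foo; rewrite le_measure ?inE//; exact: subIsetl.
have [|l [lF lm lb]] := ih _ mF2 F2oo.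
  move=> x [/Fz[w]]; rewrite in_cons => /predU1P[->//|wzs xw _].
  by exists w.
have muFT := muF setT measurableT; rewrite !setIT in muFT.
have [F10|/set0P[y [Fy yz]]] := eqVneq (F `&` eball z (eta / 2)) set0.
  exists l; split.
  - by move=> q /lF[[]].
  - by rewrite lm muFT F10 measure0 add0e.
  - move=> x r; apply: le_trans (lb x r) _.
    have mB' := measurable_eball x (r + eta).
    by rewrite le_measure ?inE//; [exact: measurableI|exact: measurableI|move=> w [[]]].
have w0 : 0 <= fine (mu (F `&` eball z (eta / 2))) by rewrite fine_ge0.
have wE : (fine (mu (F `&` eball z (eta / 2))))%:E = mu (F `&` eball z (eta / 2)).
  by rewrite fineK// ge0_fin_numE.
exists ((y, fine (mu (F `&` eball z (eta / 2)))) :: l); split.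
- by move=> q; rewrite in_cons => /predU1P[->//|/lF[[]]].
- by rewrite big_cons EFinD wE lm muFT.
- move=> x r; rewrite big_cons/=; have mxr := measurable_eball x (r + eta).
  rewrite (muF _ mxr); case: ifPn => xy; last first.
    by apply: le_trans (lb x r) _; rewrite leeDr.
  rewrite EFinD leeD//; rewrite wE.
  (* The piece has diameter less than [eta], so if [y] is within [r] of [x] the whole piece is
     within [r + eta]. *)
  rewrite (_ : _ `&` eball x (r + eta) = F `&` eball z (eta / 2))//.
  apply/seteqP; split => [w []//|w [Fw wz]]; split => //; rewrite /eball/=.
  have := enorm_tri y w x; have := enorm_tri z w y.
  rewrite (enorm_subC z y) (enorm_subC y x).
  move: wz yz xy; rewrite /eball/=; lra.
Qed.

(* Point masses have an explicitly harmonic potential: no differentiation under the integral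
   sign against mu is needed. *)
Lemma discretize (eta : R) (x0 : 'rV[R]_n) (r0 : R) (F : set T) :
  0 < eta -> measurable F -> (mu F < +oo)%E -> F `<=` ecball x0 r0 ->
  exists l : seq ('rV[R]_n * R),
  [/\ forall q, q \in l -> F q.1 /\ 0 <= q.2,
      (\sum_(q <- l) q.2)%:E = mu F
    & forall (x : 'rV[R]_n) r,
      ((\sum_(q <- l | enorm (x - q.1) < r) q.2)%:E <= mu (F `&` eball x (r + eta)))%E].
Proof.
move=> eta0 mF Foo Fb.
have := compact_ecball x0 r0; rewrite compact_cover.
move=> /(_ _ (ecball x0 r0) (fun z => eball z (eta / 2))) [].
- by move=> i _; exact: open_eball.
- by move=> x xb; exists x => //; rewrite /eball/= subrr enorm0 divr_gt0.
move=> D _ DB.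
have [|l ?] := discretize_cover eta (finmap.enum_fset D) F mF Foo; last by exists l.
move=> x /Fb /DB[z/= zD xz].
by exists z.
Qed.

End Discretization.

(** * Decay of the measure of small balls *)

(* The weight h of the theorem is not assumed measurable, so that the integral in its
   hypothesis is only a lower integral. *)
Lemma ge0_le_integral_nonmeasurable d (T : measurableType d) (R : realType)
    (mu : {measure set T -> \bar R}) (D : set T) (f1 f2 : T -> \bar R) :
  (forall x, D x -> (0 <= f1 x)%E) -> (forall x, D x -> (f1 x <= f2 x)%E) ->
  (\int[mu]_(x in D) f1 x <= \int[mu]_(x in D) f2 x)%E.
Proof.
move=> f10 f12.
have f20 x : D x -> (0 <= f2 x)%E by move=> Dx; exact: le_trans (f10 x Dx) (f12 x Dx).
rewrite !ge0_integralE//; apply: le_ereal_sup => _ [g/= gf <-].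
exists g => // x; apply: (le_trans (gf x)); rewrite /patch.
by case: ifPn => // /set_mem /f12.
Qed.

(** The tail sum [T j] is at most [K * b j], so removing [b j] from it leaves at most
    [(1 - K^-1) * T j]. Tails are truncated at [k], which keeps all sums finite. *)
Lemma geometric_decay (R : realFieldType) (b : nat -> R) (K : R) :
  (forall k, 0 < b k) ->
  (forall j N, \sum_(i < N) b (j + i)%N <= K * b j) ->
  forall k, b k <= K * (1 - K^-1) ^+ k * b 0%N.
Proof.
move=> b0 bK k.
have K1 : 1 <= K.
  have := bK 0%N 1%N; rewrite big_ord_recl big_ord0 addr0 addn0.
  by rewrite -[X in X <= _]mul1r ler_pM2r.
have K0 : 0 < K by exact: lt_le_trans K1.
pose T j := \sum_(i < k.+1 - j) b (j + i)%N.
have TS j : (j <= k)%N -> T j = b j + T j.+1.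
  move=> jk; rewrite /T subSn// big_ord_recl addn0 subSS; congr (_ + _).
  by apply: eq_bigr => i _; rewrite lift0 addSnnS.
have Tl j : (j <= k)%N -> T j <= (1 - K^-1) ^+ j * T 0%N.
  elim: j => [_|j ih jk]; first by rewrite expr0 mul1r.
  have {}ih := ih (ltnW jk).
  have Kb : K^-1 * T j <= b j by rewrite ler_pdivrMl//; exact: bK.
  have l0 : 0 <= 1 - K^-1 by rewrite subr_ge0 invf_le1.
  rewrite exprS -mulrA; apply: le_trans (ler_wpM2l l0 ih).
  have := TS j (ltnW jk); lra.
have T0K : T 0%N <= K * b 0%N by exact: bK.
have bT : b k <= T k.
  by rewrite TS// /T subnn big_ord0 addr0.
apply: (le_trans bT); apply: (le_trans (Tl k (leqnn k))).
rewrite mulrAC [leRHS]mulrC ler_wpM2l//.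
by rewrite exprn_ge0// subr_ge0 invf_le1.
Qed.

Section GrowthDecay.
Context {R : realType}.
Variables (m : nat) (h g : R -> R) (M c A B r1 : R).
Hypotheses (c4 : 4 <= c) (M0 : 0 <= M) (A0 : 0 < A) (B0 : 0 < B).
Hypothesis h0 : forall r, 0 < r -> 0 < h r.
Hypothesis gh : forall r, 0 < r -> r < r1 -> A * h r <= g r <= B * h r.
Hypothesis g_nd : forall r s, 0 < r -> r <= s -> s < r1 -> g r <= g s.

Let lt4 (x : R) : 0 < x -> x < 4 * x. Proof. lra. Qed.

(** Here [m] is [n - 2] and [g] stands for the measure of [K] in balls about [x0]. Unlike [h], [g]
    is known to be monotone, which bounds [h] below on each ring [[ek, 4 ek)] by [g (ek k) / B]. The
    rings are disjoint and lie in []0, c e[] because [4 <= c]. *)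
Lemma dyadic_sum_le (e : R) (N : nat) : 0 < e -> 4 * e < r1 ->
  (\int[lebesgue_measure]_(r in `]0%R, (c * e)%R[) (h r / r ^+ m.+1)%:E
     <= (M * h e / e ^+ m)%:E)%E ->
  \sum_(k < N) g (e / 4 ^+ k) / (e / 4 ^+ k) ^+ m <=
    (B * M * 4 ^+ m.+1 / (3 * A)) * (g e / e ^+ m).
Proof.
move=> e0 er1 Ih.
pose ek k : R := e / 4 ^+ k.
have ek0 k : 0 < ek k by rewrite divr_gt0// exprn_gt0.
have ekS k : 4 * ek k.+1 = ek k.
  by rewrite /ek exprS; field; rewrite expf_neq0.
have ek_le j k : (j <= k)%N -> ek k <= ek j.
  move=> jk; rewrite /ek ler_pM2l// lef_pV2 ?posrE ?exprn_gt0//.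
  by rewrite ler_eXn2l// ltr1n.
have eke k : ek k <= e by have := ek_le 0%N k (leq0n k); rewrite {2}/ek expr0 divr1.
pose ck k := g (ek k) / B / (4 * ek k) ^+ m.+1.
pose I k : set (measurableTypeR R) := `[ek k, (4 * ek k)%R[%classic.
have mI k : measurable (I k) by exact: measurable_itv.
have g0 k : 0 < g (ek k).
  have /andP[+ _] := gh (ek k) (ek0 k) (le_lt_trans (eke k) (lt_trans (lt4 _ e0) er1)).
  by apply: lt_le_trans; rewrite mulr_gt0// h0.
have ck0 k : 0 <= ck k by rewrite !divr_ge0// ?exprn_ge0// ?mulr_ge0// ltW.
have disj j k x : (j < k)%N -> I j x -> I k x -> False.
  move=> jk; rewrite /I/= !in_itv/= => /andP[jx _] /andP[_ xk].
  case: k jk xk => // k; rewrite ltnS ekS => /ek_le jk xk.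
  by have := lt_le_trans xk (le_trans jk jx); rewrite ltxx.
(* A step function below the integrand; its integral is computed explicitly. *)
pose s (r : R) : \bar R := (\sum_(k < N) (ck k)%:E * (\1_(I k) r)%:E)%E.
have Is : (\int[lebesgue_measure]_(r in `]0%R, (c * e)%R[) s r =
    (\sum_(k < N) ck k * (3 * ek k))%:E)%E.
  rewrite /s ge0_integral_sum//; last 2 first.
    - move=> k; apply: measurable_funeM; apply/measurable_EFinP.
      exact: measurable_indic.
    - by move=> k x _; rewrite -EFinM lee_fin mulr_ge0.
  rewrite -sumEFin; apply: eq_bigr => k _.
  rewrite ge0_integralZl_EFin//; last first.
    by apply/measurable_EFinP; exact: measurable_indic.
  rewrite integral_indic// [RHS]EFinM; congr (_ * _)%E.
  rewrite (_ : _ `&` _ = I k); last first.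
    apply/seteqP; split => [x []//|x Ix]; split => //.
    move: Ix; rewrite /I/= !in_itv/= => /andP[kx xk]; rewrite (lt_le_trans (ek0 k))//=.
    apply: (lt_le_trans xk); apply: ler_pM => //; exact: ltW.
  etransitivity; first exact: lebesgue_measure_itv.
  rewrite /= lte_fin lt4// -EFinB.
  by congr EFin; ring.
have sh r : `]0%R, (c * e)%R[%classic r -> (s r <= (h r / r ^+ m.+1)%:E)%E.
  rewrite /= in_itv/= => /andP[r0 _].
  have hr0 : 0 <= h r / r ^+ m.+1 by rewrite divr_ge0 ?exprn_ge0// ltW// h0.
  have [[k Ik]|nI] := pselect (exists k : 'I_N, I k r); last first.
    rewrite /s big1// => k _; rewrite indicE memNset ?mule0// => Ik.
    by apply: nI; exists k.
  rewrite /s (bigD1 k)//= big1 ?adde0; last first.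
    move=> j jk; rewrite indicE memNset ?mule0// => Ij.
    move: jk; rewrite -val_eqE neq_ltn => /orP[] jk.
    - exact: disj jk Ij Ik.
    - exact: disj jk Ik Ij.
  rewrite indicE mem_set// mule1 lee_fin.
  move: Ik; rewrite /I/= in_itv/= => /andP[kr rk].
  have rr1 : r < r1.
    by apply: (lt_trans rk); apply: le_lt_trans er1; rewrite ler_pM2l.
  have /andP[_ gB] := gh r r0 rr1.
  apply: ler_pM.
  - by rewrite divr_ge0// ltW.
  - by rewrite invr_ge0 exprn_ge0// mulr_ge0// ltW.
  - rewrite ler_pdivrMr// [leRHS]mulrC; apply: le_trans gB.
    exact: g_nd.
  - rewrite lef_pV2 ?posrE ?exprn_gt0 ?mulr_gt0//.
    by rewrite ler_pXn2r ?nnegrE ?mulr_ge0 ?(ltW rk)// ltW.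
have s0 r : `]0%R, (c * e)%R[%classic r -> (0 <= s r)%E.
  by move=> _; apply: sume_ge0 => k _; rewrite -EFinM lee_fin mulr_ge0.
have := le_trans (ge0_le_integral_nonmeasurable _ _ _ lebesgue_measure _ _ _ s0 sh) Ih.
rewrite Is lee_fin => H.
(* The length [3 * ek k] of the ring cancels one power of the radius, leaving exponent [m]. *)
have -> : \sum_(k < N) g (ek k) / ek k ^+ m =
    (B * 4 ^+ m.+1 / 3) * \sum_(k < N) ck k * (3 * ek k).
  rewrite mulr_sumr; apply: eq_bigr => k _; rewrite /ck [(4 * ek k) ^+ _]exprMn [ek k ^+ m.+1]exprS.
  have p4 : (4 : R) ^+ m.+1 != 0 by rewrite expf_neq0.
  have pe : ek k ^+ m != 0 by rewrite expf_neq0// gt_eqF.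
  by field; rewrite pe p4 !gt_eqF.
have K0 : 0 <= B * 4 ^+ m.+1 / 3 by rewrite divr_ge0// mulr_ge0// ?exprn_ge0// ltW.
apply: (le_trans (ler_wpM2l K0 H)).
have e_r1 : e < r1 by apply: lt_trans er1; exact: lt4.
have /andP[gA _] := gh e e0 e_r1.
have -> : B * M * 4 ^+ m.+1 / (3 * A) * (g e / e ^+ m) =
    B * 4 ^+ m.+1 / 3 * (M * (g e / A) / e ^+ m).
  have pe : e ^+ m != 0 by rewrite expf_neq0// gt_eqF.
  by field; rewrite pe !gt_eqF.
rewrite ler_wpM2l// ler_wpM2r ?invr_ge0 ?exprn_ge0 ?(ltW e0)// ler_wpM2l//.
by rewrite ler_pdivlMr// mulrC.
Qed.

(** The densities [g(r) / r^m] at [r = e / 4^j] satisfy the hypothesis of [geometric_decay], since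
    [dyadic_sum_le] can be started at any of these radii. *)
Lemma dyadic_decay (e2 K : R) : B * M * 4 ^+ m.+1 / (3 * A) <= K ->
  (forall e, 0 < e -> e < e2 ->
    (\int[lebesgue_measure]_(r in `]0%R, (c * e)%R[) (h r / r ^+ m.+1)%:E
     <= (M * h e / e ^+ m)%:E)%E) ->
  forall e k, 0 < e -> e < e2 -> 4 * e < r1 ->
  g (e / 4 ^+ k) * (4 ^+ m) ^+ k <= K * (1 - K^-1) ^+ k * g e.
Proof.
move=> KE Ih e k e0 ee2 er1.
have e40 j : 0 < e / 4 ^+ j by rewrite divr_gt0// exprn_gt0.
have e4e j : e / 4 ^+ j <= e.
  by rewrite ler_pdivrMr ?exprn_gt0// ler_peMr ?(ltW e0)// exprn_ege1// ler1n.
have e4r j : 4 * (e / 4 ^+ j) < r1.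
  by apply: le_lt_trans er1; rewrite ler_pM2l.
pose b j := g (e / 4 ^+ j) / (e / 4 ^+ j) ^+ m.
have b0 j : 0 < b j.
  rewrite divr_gt0// ?exprn_gt0//.
  have /andP[+ _] := gh _ (e40 j) (lt_trans (lt4 _ (e40 j)) (e4r j)).
  by apply: lt_le_trans; rewrite mulr_gt0// h0.
have := geometric_decay _ b K b0 _ k.
have bK j N : \sum_(i < N) b (j + i)%N <= K * b j.
  apply: (@le_trans _ _ (B * M * 4 ^+ m.+1 / (3 * A) * b j)); last by rewrite ler_wpM2r// ltW.
  have := dyadic_sum_le (e / 4 ^+ j) N (e40 j) (e4r j) (Ih _ (e40 j) (le_lt_trans (e4e j) ee2)).
  apply: le_trans; rewrite le_eqVlt; apply/orP; left; apply/eqP; apply: eq_bigr => i _.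
  by rewrite /b exprD invfM mulrA.
move=> /(_ bK); rewrite /b expr0 divr1 !mulrA ler_pdivlMr ?exprn_gt0//.
rewrite expr_div_n -exprM mulnC exprM; apply: le_trans.
rewrite le_eqVlt; apply/orP; left; apply/eqP.
have pe : e ^+ m != 0 by rewrite expf_neq0// gt_eqF.
by field; rewrite pe !expf_neq0.
Qed.

End GrowthDecay.

(** * Weak type estimate *)

Lemma sum_geometric_le (R : realFieldType) (lam : R) (N : nat) : 0 <= lam -> lam < 1 ->
  \sum_(k < N) lam ^+ k <= (1 - lam)^-1.
Proof.
move=> l0 l1; have l1' : 0 < 1 - lam by rewrite subr_gt0.
have E : (1 - lam) * \sum_(k < N) lam ^+ k = 1 - lam ^+ N.
  by rewrite -(opprB lam) mulNr -subrX1 opprB.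
rewrite -(ler_pM2l l1') E divff ?gt_eqF// lerBlDr lerDl exprn_ge0//.
Qed.

(** Bounds the sum by [N q^N] and then [N] by [4^N]. This covers [q = 1], the logarithmic case,
    where the terms do not grow. *)
Lemma sum_powers_le (R : realFieldType) (q : R) (N : nat) : 1 <= q ->
  \sum_(k < N) q ^+ k <= (4 * q) ^+ N.
Proof.
move=> q1; apply: (@le_trans _ _ (\sum_(k < N) q ^+ N)).
  by apply: ler_sum => k _; rewrite ler_weXn2l// ltnW.
rewrite sumr_const card_ord exprMn -[leLHS]mulr_natl ler_wpM2r//.
  by rewrite exprn_ge0// (le_trans ler01).
by rewrite -natrX ler_nat ltnW// ltn_expl.
Qed.

Section WeakType.
Context {R : realType}.
Variables (m : nat).
Local Notation n := m.+2.
Local Notation q := (4 ^+ m : R).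

(* Layer-cake decomposition of the kernel over the dyadic radii 4e / 4^k. *)
Lemma fund_dyadic (e rho : R) (L : nat) : 0 < e -> 4 * e / 4 ^+ L <= rho ->
  fund n (rho ^+ 2) - fund n ((4 * e) ^+ 2) <=
  \sum_(k < L) (16 * e ^+ 2 / e ^+ n) * q ^+ k *+ (rho < 4 * e / 4 ^+ k)%R.
Proof.
move=> e0; pose a k : R := 4 * e / 4 ^+ k.
have a0 k : 0 < a k by rewrite /a divr_gt0 ?mulr_gt0 ?exprn_gt0.
have aS k : a k = 4 * a k.+1 by rewrite /a exprS; field; rewrite expf_neq0.
have a_le j k : (j <= k)%N -> a k <= a j.
  move=> jk; rewrite /a ler_pM2l ?mulr_gt0// lef_pV2 ?posrE ?exprn_gt0//.
  by rewrite ler_eXn2l// ltr1n.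
have aE : 4 * e = a 0%N by rewrite /a expr0 divr1.
have term0 k : 0 <= (16 * e ^+ 2 / e ^+ n) * q ^+ k.
  by rewrite !mulr_ge0 ?invr_ge0 ?exprn_ge0// ltW.
(* Since [a k.+1 = e / 4 ^+ k], the bound of [fund_ub] with its term [- a k.+1 ^+ 2] discarded is
   exactly the right-hand side. *)
have step k : fund n (a k.+1 ^+ 2) - fund n (a k ^+ 2) <= (16 * e ^+ 2 / e ^+ n) * q ^+ k.
  have ak : a k.+1 <= a k by exact: a_le.
  apply: (le_trans (fund_ub n _ _ (a0 k.+1) ak)).
  have -> : (16 * e ^+ 2 / e ^+ n) * q ^+ k = a k ^+ 2 / a k.+1 ^+ n.
    have -> : a k.+1 = e / 4 ^+ k by rewrite /a exprS; field; rewrite expf_neq0.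
    have -> : q ^+ k = (4 ^+ k) ^+ m by rewrite -!exprM mulnC.
    have pe : e != 0 by rewrite gt_eqF.
    have p4 : (4 ^+ k : R) != 0 by rewrite expf_neq0.
    rewrite /a; move: (4 ^+ k) p4 => P p4; rewrite !expr_div_n !exprS !expr0.
    by field; rewrite !expf_neq0 ?pe ?p4.
  rewrite ler_wpM2r ?invr_ge0 ?exprn_ge0 ?(ltW (a0 _))//.
  by rewrite gerBl exprn_ge0// ltW.
suff H : a L <= rho -> fund n (rho ^+ 2) - fund n (a 0%N ^+ 2) <=
    \sum_(k < L) (16 * e ^+ 2 / e ^+ n) * q ^+ k *+ (rho < a k)%R.
  by rewrite [in X in _ - fund _ X]aE; exact: H.
elim: L => [|L ih] aL.
  by rewrite big_ord0 subr_le0; exact: fund_noninc.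
(* If [a L <= rho] the new indicator vanishes and induction applies. Otherwise [rho] is below every
   radius [a k] with [k <= L], all indicators are 1, and the increments telescope. *)
rewrite big_ord_recr/=; have [aLr|raL] := leP (a L) rho.
  by rewrite mulr0n addr0; exact: ih.
rewrite mulr1n (eq_bigr (fun k : 'I_L => (16 * e ^+ 2 / e ^+ n) * q ^+ k)); last first.
  by move=> k _; rewrite (lt_le_trans raL)// a_le// ltnW.
apply: (@le_trans _ _ (fund n (a L.+1 ^+ 2) - fund n (a 0%N ^+ 2))).
  by rewrite lerD2r; exact: fund_noninc.
rewrite -(big_ord_recr _ (fun k : 'I_L.+1 => (16 * e ^+ 2 / e ^+ n) * q ^+ k)).
have -> : fund n (a L.+1 ^+ 2) - fund n (a 0%N ^+ 2) =
    \sum_(k < L.+1) (fund n (a k.+1 ^+ 2) - fund n (a k ^+ 2)).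
  by rewrite -(big_mkord xpredT (fun k => fund n (a k.+1 ^+ 2) - fund n (a k ^+ 2))) telescope_sumr.
by apply: ler_sum.
Qed.

End WeakType.

(** * Sublevel sets and measurability of subharmonic functions *)

Section UpperSemicontinuous.
Context {R : realType} {n : nat}.
Variables (Omega : set 'rV[R]_n) (u : 'rV[R]_n -> \bar R).
Hypotheses (oO : open Omega) (subh : subharmonic Omega u).

Lemma open_sublevel (a : R) : open [set x | Omega x /\ (u x < a%:E)%E].
Proof.
rewrite openE => x [Ox ua]; have [_ usc _ _] := subh.
have nO : nbhs x Omega by exact: open_nbhs_nbhs.
exact: (filterI nO (usc x Ox a ua)).
Qed.

Lemma measurable_subharmonic (D : set (borelRn R n)) : measurable D -> D `<=` Omega ->
  measurable_fun D (u : borelRn R n -> \bar R).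
Proof.
move=> mD DO; apply: (measurability _ (ErealGenInftyO.measurableE R)).
move=> _ /= -[_ [a ->] <-].
rewrite (_ : _ `&` _ = D `&` [set x | Omega x /\ (u x < a%:E)%E]).
  by apply: measurableI => //; apply: open_measurable_Rn; exact: open_sublevel.
apply/seteqP; split => x /=; rewrite in_itv/=.
  by move=> [Dx ua]; do ! split => //; exact: DO.
by move=> [Dx [_ ua]].
Qed.

End UpperSemicontinuous.

(** * Bounds for the potential, the level sets and the integral of [b - u] *)

Section WeakTypeEstimate.
Context {R : realType}.
Variables (m : nat).
Local Notation n := m.+2.
Local Notation q := (4 ^+ m : R).
Variables (mu : {measure set (borelRn R n) -> \bar R}) (K : set (borelRn R n)).
Variables (x0 : 'rV[R]_n) (e G0 Cd lam : R).
Hypotheses (e0 : 0 < e) (G00 : 0 < G0) (Cd0 : 0 < Cd) (lam0 : 0 < lam) (lam1 : lam < 1).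
Hypothesis mK : measurable K.
Hypothesis muD : mu (K `&` eball x0 e) = G0%:E.
Hypothesis decay : forall (x : 'rV[R]_n) k, K x ->
  (mu (K `&` eball x (e / 4 ^+ k)) <= (Cd * lam ^+ k * G0 / q ^+ k)%:E)%E.

(* Radii above e / 4^N are bounded by the total mass, the others by [decay]. *)
Lemma potential_le (F : set (borelRn R n)) (eta : R) (l : seq ('rV[R]_n * R)) :
  measurable F -> 0 < eta -> F `<=` K ->
  (forall p, p \in l -> F p.1 /\ 0 <= p.2) ->
  (forall (x : 'rV[R]_n) r,
      ((\sum_(p <- l | enorm (x - p.1) < r) p.2)%:E <= mu (F `&` eball x (r + eta)))%E) ->
  forall (x : 'rV[R]_n) p, p \in l -> enorm (x - p.1) <= eta ->
     (forall p', p' \in l -> eta <= enorm (x - p'.1)) -> forall N,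
     \sum_(p' <- l) p'.2 * (fund n (nsq (x - p'.1)) - fund n ((4 * e) ^+ 2)) <=
     16 * e ^+ 2 / e ^+ n * ((4 * q) ^+ N.+2 * \sum_(p <- l) p.2 +
        q ^+ 2 * Cd * G0 * lam ^+ N / (1 - lam)).
Proof.
move=> mF eta0 FK lF lb x p pl xp xl N.
set w := \sum_(p <- l) p.2.
have w0 : 0 <= w by rewrite /w big_seq; apply: sumr_ge0 => p' /lF[].
have q1 : 1 <= q by rewrite exprn_ege1// ler1n.
have q0 : 0 < q by exact: lt_le_trans q1.
pose a k : R := 4 * e / 4 ^+ k.
have a0 k : 0 < a k by rewrite /a divr_gt0 ?mulr_gt0 ?exprn_gt0.
have a_le j k : (j <= k)%N -> a k <= a j.
  move=> jk; rewrite /a ler_pM2l ?mulr_gt0// lef_pV2 ?posrE ?exprn_gt0//.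
  by rewrite ler_eXn2l// ltr1n.
(* No mass is closer to [x] than [eta], so the dyadic decomposition may stop at a radius below
   [eta]. *)
have [L' aL'] : exists L', a L' <= eta.
  exists (Num.truncn (4 * e / eta)).+1; rewrite /a ler_pdivrMr ?exprn_gt0// [leRHS]mulrC.
  rewrite -ler_pdivrMr//; apply: (le_trans (ltW (truncnS_gt _))).
  by rewrite -(natrX _ 4) ler_nat ltnW// ltn_expl.
pose L := (N.+2 + L')%N.
have aL : a L <= eta by apply: le_trans aL'; apply: a_le; rewrite leq_addl.
pose D : R := 16 * e ^+ 2 / e ^+ n.
have D0 : 0 < D by apply: divr_gt0; [apply: mulr_gt0 => //; exact: exprn_gt0|exact: exprn_gt0].
pose W k := \sum_(p' <- l | enorm (x - p'.1) < a k) p'.2.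
have Ww k : W k <= w.
  rewrite /W /w big_mkcond/= big_seq [leRHS]big_seq; apply: ler_sum => p' /lF[_ p0].
  by case: ifP.
(* The shift by 2 pays for moving the centre from [x] to the point [p.1] of [K]: if [eta < a k.+2],
   the ball of radius [a k.+2 + eta] about [x] lies in that of radius [4 * a k.+2 = e / 4 ^+ k]
   about [p.1]. Otherwise [W k.+2] is zero. *)
have Wdecay k : W k.+2 <= Cd * lam ^+ k * G0 / q ^+ k.
  have [ak|ak] := leP (a k.+2) eta.
    rewrite /W big_seq_cond big1 ?divr_ge0 ?mulr_ge0 ?exprn_ge0// ?(ltW lam0) ?ltW//.
    move=> p' /andP[/xl xp' /lt_le_trans] /(_ _ ak).
    by rewrite ltNge xp'.
  rewrite -lee_fin; apply: (le_trans (lb x (a k.+2))).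
  apply: le_trans (decay p.1 k (FK _ (lF _ pl).1)).
  have mB (y : 'rV[R]_n) (r : R) := measurable_eball y r.
  rewrite le_measure ?inE//; [exact: measurableI|exact: measurableI|].
  move=> y [/FK Ky yx]; split => //; rewrite /eball/=.
  have -> : e / 4 ^+ k = 4 * a k.+2.
    by rewrite /a !exprS; field; rewrite expf_neq0.
  have := enorm_tri x y p.1; move: yx; rewrite /eball/=; lra.
apply: (@le_trans _ _ (\sum_(k < L) D * q ^+ k * W k)).
  apply: (@le_trans _ _ (\sum_(p' <- l) p'.2 *
      \sum_(k < L) D * q ^+ k *+ (enorm (x - p'.1) < a k)%R)).
    rewrite big_seq [leRHS]big_seq; apply: ler_sum => p' pl'.
    have [_ p0] := lF _ pl'; rewrite ler_wpM2l// -enorm_sqr.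
    by apply: fund_dyadic => //; apply: le_trans (xl _ pl').
  rewrite le_eqVlt; apply/orP; left; apply/eqP.
  under eq_bigr => p' _ do rewrite mulr_sumr.
  rewrite exchange_big/=; apply: eq_bigr => k _.
  rewrite /W mulr_sumr [RHS]big_mkcond/=; apply: eq_bigr => p' _.
  by case: ifP => _; rewrite ?mulr1n ?mulr0n ?mulr0// mulrC.
rewrite -/D (eq_bigr (fun k : 'I_L => D * (q ^+ k * W k))); last by move=> k _; rewrite mulrA.
rewrite -mulr_sumr ler_pM2l// /L big_split_ord/=; apply: lerD.
  apply: (@le_trans _ _ (\sum_(k < N.+2) q ^+ k * w)).
    by apply: ler_sum => k _; rewrite ler_wpM2l// exprn_ge0// ltW.
  by rewrite -mulr_suml ler_wpM2r// sum_powers_le.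
(* The growth [q ^+ (N + k)] of the kernel cancels against the decay of the measure; what remains is
   geometric in [lam]. *)
apply: (@le_trans _ _ (\sum_(k < L') q ^+ 2 * Cd * G0 * lam ^+ N * lam ^+ k)).
  apply: ler_sum => k _; rewrite !addSn.
  apply: (@le_trans _ _ (q ^+ (N + k).+2 * (Cd * lam ^+ (N + k) * G0 / q ^+ (N + k)))).
    by rewrite ler_wpM2l// exprn_ge0// ltW.
  have qn : q ^+ (N + k) != 0 by rewrite expf_neq0// gt_eqF.
  rewrite [lam ^+ (N + k)]exprD !exprS expr0 le_eqVlt; apply/orP; left; apply/eqP.
  move: (q ^+ (N + k)) qn => Q qn.
  by field.
rewrite -mulr_sumr ler_wpM2l//; last by apply: sum_geometric_le => //; exact: ltW.
by rewrite !mulr_ge0 ?exprn_ge0// ltW.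
Qed.

(** The first factor is the ratio of [16 e^2 / e^n] in [potential_le] to [15 e^2 / (4 e)^n] in
    [capacity_bound]; the second adds the coefficients of the two terms of the potential bound. *)
Let C3 : R := 16 * 4 ^+ n / 15 * ((4 * q) ^+ 2 + q ^+ 2 * Cd / (1 - lam)).

Variables (Omega : set 'rV[R]_n) (u : 'rV[R]_n -> \bar R) (b u0 : R).
Hypotheses (subh : subharmonic Omega u) (bO : ecball x0 (5 * e) `<=` Omega).
Hypothesis ub : forall x, ecball x0 (5 * e) x -> (u x <= b%:E)%E.
Hypotheses (ux0 : u x0 = u0%:E) (u0b : u0 < b).

(** Applies [capacity_bound] to a discretization of [mu] on [F]. The free [N] balances the small
    coefficient [lam ^+ N] of the fixed mass [G0] against the large one of [mu F]. *)
Lemma weak_type_inner (F : set (borelRn R n)) (eta t : R) (N : nat) :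
  measurable F -> 0 < eta -> F `<=` K `&` eball x0 e -> b - u0 < t ->
  (forall x y, F x -> ecball x eta y -> (u y <= (b - t)%:E)%E) ->
  t * fine (mu F) <= C3 * (b - u0) * ((4 * q) ^+ N * fine (mu F) + lam ^+ N * G0).
Proof.
move=> mF eta0 FD tb Fu.
have mB (y : 'rV[R]_n) (r : R) := measurable_eball y r.
have Foo : (mu F < +oo)%E.
  apply: (@le_lt_trans _ _ G0%:E); last exact: ltry.
  by rewrite -muD le_measure ?inE//; exact: measurableI.
have FB : F `<=` ecball x0 e by move=> x /FD[_ /ltW].
have [l [lF lm lb]] := discretize mu eta x0 e F eta0 mF Foo FB.
have FK : F `<=` K by move=> x /FD[].
set w := fine (mu F).
have wE : \sum_(p <- l) p.2 = w by rewrite /w -lm.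
have w0 : 0 <= w by rewrite /w fine_ge0.
have t0 : 0 < t by apply: le_lt_trans tb; rewrite subr_ge0 ltW.
have D0 : 0 < 16 * e ^+ 2 / e ^+ n.
  by apply: divr_gt0; [apply: mulr_gt0 => //; exact: exprn_gt0|exact: exprn_gt0].
have l1 : 0 < 1 - lam by rewrite subr_gt0.
have q0 : 0 < q by rewrite exprn_gt0.
pose Q := 16 * e ^+ 2 / e ^+ n * ((4 * q) ^+ N.+2 * w + q ^+ 2 * Cd * G0 * lam ^+ N / (1 - lam)).
have Q0 : 0 < Q.
  apply: mulr_gt0 => //; apply: ltr_wpDl.
    by apply: mulr_ge0 => //; apply: exprn_ge0; rewrite mulr_ge0// ltW.
  by apply: divr_gt0 => //; do ! apply: mulr_gt0 => //; exact: exprn_gt0.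
have cap : t * ((15 * e ^+ 2) / (4 * e) ^+ n * \sum_(p <- l) p.2) <= Q * (b - u0).
  apply: (capacity_bound Omega u subh x0 e eta b t Q u0 l) => //.
  - move=> p /lF[Fp p0]; split => //; first by have [_] := FD _ Fp.
    by move=> y py; exact: Fu py.
  - move=> x p pl xp xl; rewrite /Q -wE.
    exact: (potential_le F eta l mF eta0 FK lF lb x p pl xp xl N).
  - by rewrite ltrBlDl -ltrBlDr.
move: cap; rewrite wE => cap.
have E1 : t * ((15 * e ^+ 2) / (4 * e) ^+ n * w) =
    15 * e ^+ 2 / (4 ^+ n * e ^+ n) * (t * w) by rewrite exprMn; ring.
pose Z := (4 * q) ^+ N.+2 * w + q ^+ 2 * Cd * G0 * lam ^+ N / (1 - lam).
have cap2 : t * w <= 16 * 4 ^+ n / 15 * (b - u0) * Z.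
  have c0 : 0 < 15 * e ^+ 2 / (4 ^+ n * e ^+ n).
    by apply: divr_gt0; apply: mulr_gt0 => //; exact: exprn_gt0.
  rewrite -(ler_pM2l c0) -E1; apply: (le_trans cap); rewrite /Q -/Z.
  rewrite le_eqVlt; apply/orP; left; apply/eqP.
  have p4 : (4 ^+ n : R) != 0 by rewrite expf_neq0.
  have pe : (e ^+ n : R) != 0 by rewrite expf_neq0// gt_eqF.
  move: (4 ^+ n) (e ^+ n) p4 pe => P4 Pe p4 pe.
  by field; rewrite p4 pe.
apply: (le_trans cap2).
have bu0 : 0 < b - u0 by rewrite subr_gt0.
set A0 : R := 16 * 4 ^+ n / 15; set Y := q ^+ 2 * Cd / (1 - lam).
have A00 : 0 <= A0 by apply: divr_ge0 => //; apply: mulr_ge0 => //; exact: exprn_ge0.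
have Y0 : 0 <= Y by apply/ltW/divr_gt0 => //; apply: mulr_gt0 => //; exact: exprn_gt0.
set T := (4 * q) ^+ N; set S := lam ^+ N * G0.
have T0 : 0 <= T by apply: exprn_ge0; rewrite mulr_ge0// ltW.
have S0 : 0 <= S by apply: mulr_ge0; [apply: exprn_ge0|]; exact: ltW.
have -> : Z = (4 * q) ^+ 2 * (T * w) + Y * S.
  rewrite /Z; have -> : (4 * q) ^+ N.+2 = (4 * q) ^+ 2 * T by rewrite -exprD add2n.
  by rewrite /Y /S; field; rewrite gt_eqF.
have -> : C3 * (b - u0) * (T * w + S) = A0 * (b - u0) * (((4 * q) ^+ 2 + Y) * (T * w + S)).
  by rewrite /C3 -/A0 -/Y; ring.
rewrite ler_wpM2l//; first by rewrite mulr_ge0// ltW.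
have Tw0 : 0 <= T * w by rewrite mulr_ge0.
have q20 : 0 <= (4 * q) ^+ 2 by exact: sqr_ge0.
have qS : 0 <= (4 * q) ^+ 2 * S by exact: mulr_ge0.
have YT : 0 <= Y * (T * w) by exact: mulr_ge0.
by rewrite mulrDl !mulrDr; lra.
Qed.

Hypotheses (oO : open Omega) (KO : K `<=` Omega).

Let D := K `&` eball x0 e.

Let mD : measurable D.
Proof. by apply: measurableI => //; exact: measurable_eball. Qed.

Let C3_ge1 : 1 <= C3.
Proof.
have l1 : 0 < 1 - lam by rewrite subr_gt0.
have Y0 : 0 <= q ^+ 2 * Cd / (1 - lam).
  by apply/ltW/divr_gt0 => //; apply: mulr_gt0 => //; exact: exprn_gt0.
have q1 : 1 <= q by rewrite exprn_ege1// ler1n.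
have n1 : 1 <= (4 ^+ n : R) by rewrite exprn_ege1// ler1n.
have X1 : 1 <= (4 * q) ^+ 2 by rewrite exprn_ege1//; lra.
rewrite /C3 -[leLHS]mul1r ler_pM//; lra.
Qed.

(** For such [t] the term of [weak_type_inner] that contains [mu F] is at most half of [t * mu F],
    which is finite, and is absorbed on the left. *)
Lemma weak_type (t : R) (N : nat) : 2 * C3 * (b - u0) * (4 * q) ^+ N <= t ->
  (mu (D `&` [set x | u x < (b - t)%:E]%E) <= (2 * C3 * (b - u0) * lam ^+ N * G0 / t)%:E)%E.
Proof.
move=> tN.
have v0 : 0 < b - u0 by rewrite subr_gt0.
have q1 : 1 <= q by rewrite exprn_ege1// ler1n.
have C1 := C3_ge1.
have t2 : 2 * (b - u0) <= t.
  apply: le_trans tN; rewrite -[leLHS]mulr1; apply: ler_pM => //.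
  - by rewrite mulr_ge0// ltW.
  - by rewrite ler_wpM2r ?(ltW v0)//; lra.
  - by rewrite exprn_ege1//; lra.
have t0 : 0 < t by lra.
pose U : set 'rV[R]_n := [set y | Omega y /\ (u y < (b - t)%:E)%E].
have oU : open U by exact: open_sublevel subh _.
(* F j has a positive distance to the complement of U, as [weak_type_inner] requires. *)
pose F j : set (borelRn R n) :=
  D `&` ~` [set x | exists2 y, ~ U y & enorm (x - y) < 2 / j.+1%:R].
have mF j : measurable (F j).
  apply: measurableI => //; apply: measurableC; apply: open_measurable_Rn.
  rewrite (_ : [set x | _] = \bigcup_(y in ~` U) eball y (2 / j.+1%:R)).
    by apply: bigcup_open => y _; exact: open_eball.
  by apply/seteqP; split => x [y Uy xy]; exists y.
have FU : \bigcup_j F j = D `&` [set x | u x < (b - t)%:E]%E.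
  apply/seteqP; split => x.
    move=> [j _ [Dx nx]]; split => //; apply: contrapT => nu; apply: nx.
    by exists x; [case|rewrite subrr enorm0 divr_gt0].
  move=> [Dx ux].
  have Ux : U x by split => //; apply: KO; case: Dx.
  have [r r0 rU] := nbhs_ecball U x (open_nbhs_nbhs (conj oU Ux)).
  exists (Num.truncn (2 / r)) => //; split => // -[y nUy xy]; apply: nUy.
  apply: rU; rewrite /ecball/= enorm_subC ltW// (lt_le_trans xy)//.
  rewrite ler_pdivrMr// [leRHS]mulrC -ler_pdivrMr//.
  exact/ltW/truncnS_gt.
have ndF : nondecreasing_seq F.
  apply/nondecreasing_seqP => j; apply/subsetPset => x [Dx nx]; split => // -[y Uy xy].
  apply: nx; exists y => //; apply: (lt_le_trans xy).
  by rewrite ler_pM2l// lef_pV2 ?posrE// ler_nat.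
have mU : measurable (\bigcup_j F j) by exact: bigcupT_measurable.
(* Continuity of [mu] from below reduces the claim to each [F j]. *)
rewrite -FU; apply: (@cvge_le _ _ _ _ _ _ _ _ (nondecreasing_cvg_mu mF mU ndF)).
apply: nearW => j /=.
have j0 : 0 < (j.+1%:R : R)^-1 by rewrite invr_gt0.
have Fj : F j `<=` K `&` eball x0 e by move=> x [].
have wt := weak_type_inner (F j) (j.+1%:R)^-1 t N (mF j) j0 Fj.
have Foo : (mu (F j) < +oo)%E.
  apply: (@le_lt_trans _ _ G0%:E); last exact: ltry.
  by rewrite -muD le_measure ?inE.
rewrite -[leLHS]fineK ?ge0_fin_numE// lee_fin ler_pdivlMr//.
have {wt} := wt _ _.
have -> : b - u0 < t by lra.
move=> /(_ isT) wt.
have {}wt : t * fine (mu (F j)) <=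
    C3 * (b - u0) * ((4 * q) ^+ N * fine (mu (F j)) + lam ^+ N * G0).
  apply: wt => x y [Dx nx] xy; apply: contrapT => nuy; apply: nx; exists y.
    by move=> [_ /ltW].
  rewrite enorm_subC; apply: (le_lt_trans xy); rewrite -[ltLHS]mul1r ltr_pM2r//.
  by rewrite ltr1n.
have w0 : 0 <= fine (mu (F j)) by rewrite fine_ge0.
have := ler_wpM2r w0 tN.
move: wt; set w := fine _; set T := (4 * q) ^+ N; set S := lam ^+ N.
have -> : C3 * (b - u0) * (T * w + S * G0) = C3 * (b - u0) * T * w + C3 * (b - u0) * S * G0 by ring.
have -> : 2 * C3 * (b - u0) * T * w = 2 * (C3 * (b - u0) * T * w) by ring.
have -> : 2 * C3 * (b - u0) * S * G0 = 2 * (C3 * (b - u0) * S * G0) by ring.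
rewrite [w * t]mulrC; lra.
Qed.

(** The levels [tt N] are the smallest at which [weak_type] gives [lam ^+ N]. Consecutive ones
    differ by the factor [4 * q], so [tt N.+1] times the measure of [V N] is still geometric in
    [lam]. *)
Lemma integral_defect_le :
  (\int[mu]_(x in D) (b%:E - u x) <=
    (2 * C3 * (1 + 4 * q / (1 - lam)) * (b - u0) * G0)%:E)%E.
Proof.
have v0 : 0 < b - u0 by rewrite subr_gt0.
have q1 : 1 <= q by rewrite exprn_ege1// ler1n.
have C1 := C3_ge1.
have l1 : 0 < 1 - lam by rewrite subr_gt0.
pose tt N := 2 * C3 * (b - u0) * (4 * q) ^+ N.
have c0 : 0 < 2 * C3 * (b - u0) by rewrite mulr_gt0//; lra.
have tt0 N : 0 < tt N by rewrite mulr_gt0// exprn_gt0//; lra.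
pose V N : set (borelRn R n) := D `&` [set x | (u x < (b - tt N)%:E)%E].
have mu_u : measurable_fun D (u : borelRn R n -> \bar R).
  by apply: (measurable_subharmonic Omega) => // x [/KO].
have mV N : measurable (V N) by exact: emeasurable_fun_infty_o.
have muV N : (mu (V N) <= (2 * C3 * (b - u0) * lam ^+ N * G0 / tt N)%:E)%E.
  exact: weak_type.
have ubD x : D x -> (u x <= b%:E)%E.
  move=> [_ xe]; apply: ub; rewrite /ecball/= ltW// (lt_le_trans xe)//.
  by rewrite ler_peMl// ?(ltW e0)// ler1n.
pose f N (x : borelRn R n) : \bar R := ((tt N.+1)%:E * (\1_(V N) x)%:E)%E.
have f0 N x : (0 <= f N x)%E by rewrite /f -EFinM lee_fin mulr_ge0// ltW.
have mf N : measurable_fun D (f N).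
  apply: measurable_funeM; apply/measurable_EFinP; exact: measurable_indic.
(* v <= t_0 + sum_N t_(N+1) 1_{v > t_N}, as the levels t_N tend to infinity. *)
have vle x : D x -> (b%:E - u x <= (tt 0%N)%:E + \sum_(N <oo) f N x)%E.
  move=> Dx.
  have fS N : ((b - tt N)%:E > u x)%E -> ((tt N.+1)%:E <= \sum_(k <oo) f k x)%E.
    move=> uN; apply: (@le_trans _ _ (\sum_(0 <= k < N.+1) f k x)%E); last first.
      by apply: nneseries_lim_ge => k _ _; exact: f0.
    rewrite big_nat_recr//= /f indicE mem_set; last by split.
    by rewrite mule1 leeDr//; apply: sume_ge0 => k _; exact: f0.
  have S0 : (0 <= \sum_(k <oo) f k x)%E by apply: nneseries_ge0 => k _ _; exact: f0.
  have vN N : (b%:E - u x <= (tt N)%:E)%E = ((b - tt N)%:E <= u x)%E.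
    have := ubD x Dx; case: (u x) => [r| |]//= _.
    by rewrite -EFinB !lee_fin; apply/idP/idP; lra.
  (* If [b - u x] exceeds every level, the series dominates the unbounded sequence [tt] and equals
     [+oo]. *)
  have [[N Nx]|nN] := pselect (exists N, (b%:E - u x <= (tt N)%:E)%E); last first.
    rewrite (_ : (\sum_(k <oo) f k x)%E = +oo%E) ?addey ?leey//.
    have SN N : ((tt N.+1)%:E <= \sum_(k <oo) f k x)%E.
      by apply: fS; rewrite ltNge -vN; apply/negP => h; apply: nN; exists N.
    move: S0 SN; case: (\sum_(k <oo) f k x)%E => [r|//|//] _ SN; exfalso.
    have := SN (Num.truncn (r / (2 * C3 * (b - u0)))); apply/negP; rewrite -ltNge lte_fin.
    rewrite /tt mulrC -ltr_pdivrMr//; apply: (lt_le_trans (truncnS_gt _)).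
    apply: (@le_trans _ _ (4 ^+ (Num.truncn (r / (2 * C3 * (b - u0)))).+1)).
      by rewrite -(natrX _ 4) ler_nat ltnW// ltn_expl.
    by rewrite lerXn2r ?nnegrE; lra.
  (* At the least [N] with [b - u x <= tt N], either [N = 0] or [x] is in the preceding [V], whose
     term alone contributes [tt N]. *)
  case: (ex_minnP (ex_intro (fun N => b%:E - u x <= (tt N)%:E)%E N Nx)) => -[|N'] vN' minN'.
    by apply: (le_trans vN'); rewrite leeDl.
  apply: (le_trans vN'); apply: (@le_trans _ _ (\sum_(k <oo) f k x)%E).
    by apply: fS; rewrite ltNge -vN; apply/negP => /minN'; rewrite ltnn.
  by rewrite leeDr// lee_fin ltW.
have mS : measurable_fun D (fun x => \sum_(N <oo) f N x)%E.
  by apply: ge0_emeasurable_sum => // N x Dx _; exact: f0.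
apply: (@le_trans _ _ (\int[mu]_(x in D) ((tt 0%N)%:E + \sum_(N <oo) f N x))%E).
  apply: ge0_le_integral => //.
  - by move=> x Dx; rewrite sube_ge0 ?orbT//; exact: ubD.
  - by apply: emeasurable_funB => //; exact: measurable_cst.
  - by apply: emeasurable_funD => //; exact: measurable_cst.
rewrite ge0_integralD//; last 2 first.
  - by move=> x _; rewrite lee_fin ltW.
  - by move=> x _; apply: nneseries_ge0 => k _ _; exact: f0.
rewrite integral_cst// muD integral_nneseries//.
have intf N : (\int[mu]_(x in D) f N x <= (2 * C3 * (b - u0) * (4 * q) * G0 * lam ^+ N)%:E)%E.
  rewrite /f ge0_integralZl_EFin//; last 2 first.
    - by apply/measurable_EFinP; exact: measurable_indic.
    - exact: ltW.
  rewrite integral_indic// (_ : V N `&` D = V N); last by apply/setIidPl => x [].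
  apply: (@le_trans _ _ ((tt N.+1)%:E * (2 * C3 * (b - u0) * lam ^+ N * G0 / tt N)%:E)%E).
    by rewrite lee_pmul2l ?lte_fin//; exact: muV.
  rewrite -EFinM lee_fin le_eqVlt; apply/orP; left; apply/eqP.
  rewrite /tt exprS; field.
  by rewrite !gt_eqF// ?exprn_gt0//; lra.
have sumf : (\sum_(N <oo) \int[mu]_(x in D) f N x <=
    (2 * C3 * (b - u0) * (4 * q) * G0 / (1 - lam))%:E)%E.
  apply: lime_le.
    by apply: is_cvg_nneseries => k _ _; apply: integral_ge0 => x _; exact: f0.
  apply: nearW => N; rewrite big_mkord.
  apply: (@le_trans _ _ (\sum_(k < N) (2 * C3 * (b - u0) * (4 * q) * G0 * lam ^+ k)%:E)%E).
    by apply: lee_sum.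
  rewrite sumEFin lee_fin -mulr_sumr ler_wpM2l//.
    by apply: mulr_ge0; [apply: mulr_ge0; [|lra]|]; exact: ltW.
  by apply: sum_geometric_le => //; exact: ltW.
rewrite -EFinM; apply: (le_trans (leeD (lexx _) sumf)).
rewrite -EFinD lee_fin le_eqVlt; apply/orP; left; apply/eqP.
by rewrite /tt expr0; field; rewrite gt_eqF.
Qed.

End WeakTypeEstimate.

(** * Convergence of the averages *)

Section IntegralBounds.
Context d (T : measurableType d) (R : realType) (mu : {measure set T -> \bar R}).
Variables (D : set T) (u : T -> \bar R) (G : R).
Hypotheses (mD : measurable D) (mu_u : measurable_fun D u) (muD : mu D = G%:E).

(** The integral of [u] may be [-oo], so positive and negative parts are compared separately. *)
Lemma integral_le_cst (a : R) : (forall x, D x -> (u x <= a%:E)%E) ->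
  (\int[mu]_(x in D) u x <= (a * G)%:E)%E.
Proof.
move=> ua; rewrite EFinM -muD -(integral_cst mu mD a%:E) integralE [leRHS]integralE.
apply: leeB.
- apply: ge0_le_integral => //.
  + exact: measurable_funepos.
  + by apply: measurable_funepos; exact: measurable_cst.
  + by move=> x Dx; rewrite !funeposE /= ge_max !le_max ua//= lexx orbT.
- apply: ge0_le_integral => //.
  + by apply: measurable_funeneg; exact: measurable_cst.
  + exact: measurable_funeneg.
  + by move=> x Dx; rewrite !funenegE ge_max !le_max leeN2 [(u x <= _)%E]ua// lexx orbT.
Qed.

(** The bound makes the nonnegative function [b - u] integrable, so [u = b - (b - u)] can be
    integrated termwise. *)
Lemma cst_le_integral (b c : R) : (forall x, D x -> (u x <= b%:E)%E) ->
  (\int[mu]_(x in D) (b%:E - u x) <= (c * G)%:E)%E ->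
  (((b - c) * G)%:E <= \int[mu]_(x in D) u x)%E.
Proof.
move=> ub vc.
have iv : mu.-integrable D (fun x => b%:E - u x)%E.
  apply/integrableP; split.
    by apply: emeasurable_funB => //; exact: measurable_cst.
  apply: le_lt_trans (ltry (c * G)); apply: le_trans vc.
  apply: ge0_le_integral => //.
  - apply: measurableT_comp => //.
    by apply: emeasurable_funB => //; exact: measurable_cst.
  - by apply: emeasurable_funB => //; exact: measurable_cst.
  - by move=> x Dx; rewrite gee0_abs// sube_ge0 ?orbT//; exact: ub.
have ib : mu.-integrable D (cst b%:E).
  by apply/integrableP; split => //=; rewrite integral_cst//= muD -EFinM ltry.
have -> : (\int[mu]_(x in D) u x = \int[mu]_(x in D) (b%:E - (b%:E - u x)))%E.
  apply: eq_integral => x /set_mem /ub; case: (u x) => [r| |]//= _.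
  by rewrite -!EFinB; congr EFin; ring.
rewrite integralB// integral_cst//= muD -EFinM mulrBl EFinB.
exact: leeB.
Qed.

End IntegralBounds.

Section MainProof.
Context {R : realType}.
Variables (m : nat).
Local Notation n := m.+2.
Variables (Omega : set 'rV[R]_n) (u : 'rV[R]_n -> \bar R) (K : set (borelRn R n)) (x0 : 'rV[R]_n).
Variables (h : R -> R) (M c A B eps0 : R) (mu : {measure set (borelRn R n) -> \bar R}).
Hypotheses (oO : open Omega) (subh : subharmonic Omega u) (mK : measurable K).
Hypotheses (KO : K `<=` Omega) (Kx0 : K x0) (h0 : forall r, 0 < r -> 0 < h r).
Hypotheses (M0 : 0 < M) (c4 : 4 < c) (A0 : 0 < A) (B0 : 0 < B) (eps00 : 0 < eps0).
Hypothesis Ih : \forall e \near 0^'+,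
     (\int[lebesgue_measure]_(r in `]0%R, (c * e)%R[) (h r / r ^+ m.+1)%:E
       <= (M * h e / e ^+ m)%:E)%E.
Hypothesis lbK : forall e, 0 < e -> e < eps0 -> ((A * h e)%:E <= mu (K `&` eball x0 e))%E.
Hypothesis ubK : forall x e, K x -> 0 < e -> e < eps0 ->
     (mu (K `&` eball x e) <= (B * h e)%:E)%E.

Let g e := fine (mu (K `&` eball x0 e)).

Let mD e : measurable (K `&` eball x0 e).
Proof. by apply: measurableI => //; exact: measurable_eball. Qed.

Let muE e : 0 < e -> e < eps0 -> mu (K `&` eball x0 e) = (g e)%:E.
Proof.
move=> e0 ee; rewrite fineK// ge0_fin_numE//.
by apply: le_lt_trans (ubK x0 e Kx0 e0 ee) _; exact: ltry.
Qed.

Let gh r : 0 < r -> r < eps0 -> A * h r <= g r <= B * h r.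
Proof.
by move=> r0 re; rewrite -!lee_fin -muE// lbK//= ubK.
Qed.

Let g_nd r s : 0 < r -> r <= s -> s < eps0 -> g r <= g s.
Proof.
move=> r0 rs se; rewrite -lee_fin -!muE//; [|exact: lt_le_trans rs|exact: le_lt_trans se].
rewrite le_measure ?inE// => x [Kx xr]; split => //; exact: lt_le_trans xr rs.
Qed.

Let g_gt0 e : 0 < e -> e < eps0 -> 0 < g e.
Proof.
move=> e0 ee; have /andP[+ _] := gh e e0 ee; apply: lt_le_trans.
by rewrite mulr_gt0// h0.
Qed.

(** The order of quantifiers matters: [C] and [e2] are fixed before [b], which is later taken close
    to [u x0]. *)
Lemma uniform_integral_defect_le : exists2 C : R, 0 <= C & exists2 e2 : R, 0 < e2 <= eps0 &
  forall e b u0, 0 < e -> e < e2 -> u x0 = u0%:E -> u0 < b ->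
    ecball x0 (5 * e) `<=` Omega ->
    (forall x, ecball x0 (5 * e) x -> (u x <= b%:E)%E) ->
    (\int[mu]_(x in K `&` eball x0 e) (b%:E - u x) <= (C * (b - u0) * g e)%:E)%E.
Proof.
have [e1/= e10 He1] := Ih.
have {}He1 e : 0 < e -> e < e1 ->
    (\int[lebesgue_measure]_(r in `]0%R, (c * e)%R[) (h r / r ^+ m.+1)%:E
       <= (M * h e / e ^+ m)%:E)%E.
  by move=> e0 ee; apply: He1 => //=; rewrite /ball/= sub0r normrN gtr0_norm.
(* Adding 2 forces [K1 > 1], so that [lam] lies strictly between 0 and 1. *)
pose K1 : R := B * M * 4 ^+ m.+1 / (3 * A) + 2.
have K1gt2 : 2 < K1.
  rewrite /K1 ltrDr; apply: divr_gt0; last exact: mulr_gt0.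
  by do ! apply: mulr_gt0 => //; exact: exprn_gt0.
(* The factor [B / A] compares balls about points of [K] with balls about [x0], through [h]. *)
pose lam := 1 - K1^-1; pose Cd := B / A * K1.
have K1i : 0 < K1^-1 < 1.
  by rewrite invr_gt0 invf_lt1//; lra.
have lam0 : 0 < lam by rewrite /lam; lra.
have lam1 : lam < 1 by rewrite /lam; lra.
have Cd0 : 0 < Cd by rewrite /Cd mulr_gt0 ?divr_gt0//; lra.
pose q : R := 4 ^+ m.
pose C3 : R := 16 * 4 ^+ n / 15 * ((4 * q) ^+ 2 + q ^+ 2 * Cd / (1 - lam)).
have q0 : 0 < q by rewrite exprn_gt0.
have l1 : 0 < 1 - lam by lra.
exists (2 * C3 * (1 + 4 * q / (1 - lam))).
  apply: mulr_ge0; last by rewrite addr_ge0// divr_ge0// ?(ltW l1)// mulr_ge0// ltW.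
  apply: mulr_ge0 => //; apply: mulr_ge0.
    by apply: divr_ge0 => //; apply: mulr_ge0 => //; exact: exprn_ge0.
  rewrite addr_ge0 ?sqr_ge0//; apply: divr_ge0; last exact: ltW.
  by apply: mulr_ge0; [exact: sqr_ge0|exact: ltW].
(* The rings reach out to [4 * e], which must stay below [eps0]. *)
exists (Num.min e1 (eps0 / 4)).
  rewrite lt_min e10 divr_gt0//= ge_min; apply/orP; right.
  by rewrite ler_pdivrMr// ler_peMr ?ltW//; lra.
move=> e b u0 e0; rewrite lt_min => /andP[ee1 ee4] ux0 u0b bO ub.
have e4 : 4 * e < eps0 by move: ee4; rewrite ltr_pdivlMr// mulrC.
have eeps : e < eps0 by lra.
have ek k : 0 < e / 4 ^+ k <= e.
  rewrite divr_gt0 ?exprn_gt0//= ler_pdivrMr ?exprn_gt0// ler_peMr ?(ltW e0)//.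
  by rewrite exprn_ege1// ler1n.
have decay (x : 'rV[R]_n) k : K x ->
    (mu (K `&` eball x (e / 4 ^+ k)) <= (Cd * lam ^+ k * g e / q ^+ k)%:E)%E.
  move=> Kx; have /andP[ek0 eke] := ek k.
  have eke0 := le_lt_trans eke eeps.
  apply: (le_trans (ubK x _ Kx ek0 eke0)); rewrite lee_fin.
  have /andP[gA _] := gh _ ek0 eke0.
  have dd : g (e / 4 ^+ k) * q ^+ k <= K1 * lam ^+ k * g e.
    apply: (dyadic_decay m h g M c A B eps0 (ltW c4) (ltW M0) A0 B0 h0 gh g_nd e1) => //.
    by rewrite /K1 lerDl.
  have qk : 0 < q ^+ k by rewrite exprn_gt0.
  rewrite ler_pdivlMr//.
  apply: (@le_trans _ _ (B / A * (g (e / 4 ^+ k) * q ^+ k))).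
    by rewrite [leRHS]mulrA ler_pM2r// -mulrA ler_pM2l// ler_pdivlMl.
  rewrite (_ : Cd * lam ^+ k * g e = B / A * (K1 * lam ^+ k * g e)); last by rewrite /Cd; ring.
  by rewrite ler_pM2l// divr_gt0.
exact: (integral_defect_le m mu K x0 e (g e) Cd lam e0 (g_gt0 e e0 eeps) Cd0 lam0 lam1 mK
  (muE e e0 eeps) decay Omega u b u0 subh bO ub ux0 u0b oO KO).
Qed.

Let near_x0 (a : R) : (u x0 < a%:E)%E ->
  exists2 r, 0 < r & forall x, ecball x0 r x -> Omega x /\ (u x <= a%:E)%E.
Proof.
move=> ua; have [r r0 rU] := nbhs_ecball _ x0 (open_nbhs_nbhs
  (conj (open_sublevel Omega u oO subh a) (conj (KO _ Kx0) ua))).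
by exists r => // x /rU[Ox /ltW].
Qed.

Let avg e := ((g e)^-1%:E * \int[mu]_(x in K `&` eball x0 e) u x)%E.

Let mu_u e : measurable_fun (K `&` eball x0 e) (u : borelRn R n -> \bar R).
Proof. by apply: (measurable_subharmonic Omega) => // x [/KO]. Qed.

Let avg_le (a : R) : (u x0 < a%:E)%E -> \forall e \near 0^'+, (avg e <= a%:E)%E.
Proof.
move=> /near_x0[r r0 ru]; near=> e.
have e0 : 0 < e by near: e; exact: nbhs_right_gt.
have er : e < r by near: e; exact: nbhs_right_lt.
have ee : e < eps0 by near: e; exact: nbhs_right_lt.
have g0 := g_gt0 e e0 ee.
have := integral_le_cst _ _ _ _ _ _ _ (mD e) (mu_u e) (muE e e0 ee) a.
have ua x : (K `&` eball x0 e) x -> (u x <= a%:E)%E.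
  by move=> [_ xe]; have [] := ru x (ltW (lt_trans xe er)).
move=> /(_ ua) H; rewrite /avg.
have -> : a%:E = ((g e)^-1%:E * (a * g e)%:E)%E.
  by rewrite -EFinM mulrCA mulVf ?mulr1// gt_eqF.
by rewrite lee_pmul2l ?lte_fin ?invr_gt0.
Unshelve. all: by end_near. Qed.

Let avg_ge (u0 d : R) : u x0 = u0%:E -> 0 < d -> \forall e \near 0^'+, ((u0 - d)%:E <= avg e)%E.
Proof.
move=> ux0 d0; have [C C0 [e2 /andP[e20 e2e] HC]] := uniform_integral_defect_le.
(* With this choice [b - C * (b - u0) = u0 - d + 2 * d / (C + 1)], which is at least [u0 - d]. *)
pose b := u0 + d / (C + 1).
have bd : 0 < d / (C + 1) by rewrite divr_gt0// ltr_wpDl.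
have u0b : u0 < b by rewrite ltrDl.
have [r r0 ru] : exists2 r, 0 < r & forall x, ecball x0 r x -> Omega x /\ (u x <= b%:E)%E.
  by apply: near_x0; rewrite ux0 lte_fin.
near=> e.
have e0 : 0 < e by near: e; exact: nbhs_right_gt.
have er : e < r / 5 by near: e; apply: nbhs_right_lt; rewrite divr_gt0.
have ee2 : e < e2 by near: e; exact: nbhs_right_lt.
have ee := lt_le_trans ee2 e2e.
have g0 := g_gt0 e e0 ee.
have ru5 x : ecball x0 (5 * e) x -> Omega x /\ (u x <= b%:E)%E.
  by rewrite /ecball/= => xe; apply: ru; rewrite /ecball/=; lra.
have ub x : (K `&` eball x0 e) x -> (u x <= b%:E)%E.
  move=> [_]; rewrite /eball/= => xe.
  have xe5 : ecball x0 (5 * e) x by rewrite /ecball/=; lra.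
  by have [] := ru5 x xe5.
have HD : (\int[mu]_(x in K `&` eball x0 e) (b%:E - u x) <= (C * (b - u0) * g e)%:E)%E.
  by apply: HC => // x /ru5[].
have := cst_le_integral _ _ _ _ _ _ _ (mD e) (mu_u e) (muE e e0 ee) b _ ub HD.
move=> H; apply: (@le_trans _ _ ((g e)^-1%:E * ((b - C * (b - u0)) * g e)%:E)%E); last first.
  by rewrite /avg lee_pmul2l ?lte_fin ?invr_gt0.
rewrite -EFinM mulrCA mulVf ?mulr1 ?gt_eqF// lee_fin.
have -> : C * (b - u0) = d - d / (C + 1).
  by rewrite /b; field; rewrite gt_eqF// ltr_wpDl.
lra.
Unshelve. all: by end_near. Qed.

Lemma average_cvg : avg e @[e --> 0^'+] --> u x0.
Proof.
have [uoo _ _ _] := subh; have := uoo x0 (KO _ Kx0).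
(* When [u x0 = -oo], the upper estimate alone gives the limit. *)
case E : (u x0) => [u0| |]// _; last first.
  by apply/cvgeNyPle => a; apply: avg_le; rewrite E ltNyr.
have bounds d : 0 < d -> \forall e \near 0^'+, ((u0 - d)%:E <= avg e <= (u0 + d)%:E)%E.
  move=> d0; have lo := avg_ge u0 d E d0.
  have up : \forall e \near 0^'+, (avg e <= (u0 + d)%:E)%E.
    by apply: avg_le; rewrite E lte_fin ltrDl.
  by near=> e; apply/andP; split; near: e.
apply/fine_cvgP; split.
  have := bounds 1 ltr01; apply: filterS => e /andP[lo up].
  by rewrite fin_numElt (lt_le_trans (ltNyr _) lo) (le_lt_trans up (ltry _)).
apply/cvgrPdist_le => d d0; have := bounds d d0; apply: filterS => e /=.
case: (avg e) => [r|/andP[_]|/andP[]]; rewrite ?leye_eq ?leeNy_eq// !lee_fin.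
by move=> /andP[lo up] /=; rewrite ler_distl; apply/andP; split; lra.
Unshelve. all: by end_near. Qed.

End MainProof.

Theorem theorem1 (R : realType) (n : nat) (Omega : set 'rV[R]_n)
  (u : 'rV[R]_n -> \bar R) (K : set (borelRn R n)) (x0 : 'rV[R]_n)
  (h : R -> R) (M c : R)
  (mu : {measure set (borelRn R n) -> \bar R}) (A B eps0 : R) :
  (2 <= n)%N ->
  domain Omega ->
  subharmonic Omega u ->
  measurable K -> K `<=` Omega -> K x0 ->
  (forall r, 0 < r -> 0 < h r) ->
  0 < M -> 4 < c ->
  (\forall e \near 0^'+,
     (\int[lebesgue_measure]_(r in `]0%R, (c * e)%R[) (h r / r ^+ (n - 1))%R%:E
       <= (M * h e / e ^+ (n - 2))%R%:E)%E) ->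
  0 < A -> 0 < B -> 0 < eps0 ->
  (forall e, 0 < e -> e < eps0 -> ((A * h e)%:E <= mu (K `&` eball x0 e))%E) ->
  (forall x e, K x -> 0 < e -> e < eps0 ->
     (mu (K `&` eball x e) <= (B * h e)%:E)%E) ->
  ((fine (mu (K `&` eball x0 e)))^-1%:E *
     \int[mu]_(x in K `&` eball x0 e) u x)%E
    @[e --> 0^'+] --> u x0.
Proof.
(* Writing [n] as [m + 2] turns the truncated [n - 1] and [n - 2] into [m + 1] and [m]. *)
case: n Omega u K x0 mu => [|[|m]]// Omega u K x0 mu _ [oO _ _] subh mK KO Kx0 h0 M0 c4.
rewrite !subSS !subn0 => Ih A0 B0 eps00 lbK ubK.
exact: (average_cvg m Omega u K x0 h M c A B eps0 mu).
Qed.
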